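(* Let $\mathbb{K}\subset\mathbb{C}$ be a field and let $G\subset G(m,n,p)$ be a Lie group. Every formal matrix $A\in Mat(m,n,p)$ is $G^0$-equivalent to a unique matrix $B\in Mat(m,n,p)$ whose homogeneous summands $B^{(j)}$ satisfy the equations $$\delta\left(D_BB^{(j)}\right)(x)=\delta\left(D_B\pi_{j-1}f_j\right)(x),\qquad j=0,1,\dots$$ with some formal matrices $f_j\in Mat(m,n,p)$.
   Context: $m,n,p\ge1$ are integers. $Mat(m,n,p)$ is the space of $m\times n$ matrices with entries in $\mathbb{K}[[x_1,\dots,x_p]]$, written $A=\sum_IA_Ix^I$. Put $\pi_jA=\sum_{|I|\le j}A_Ix^I$, $\pi_{-1}=0$, and $A^{(j)}=\pi^{(j)}A=\sum_{|I|=j}A_Ix^I$; these projectors act componentwise on pairs, and $Mat^{(j)}(m,n,p)$ is the image of $\pi^{(j)}$ (homogeneous matrices of degree $j$). A sequence $A_k$ converges to $A$ if for every $j$ one has $\pi_jA_k=\pi_jA$ for all large $k$ (similarly for pairs of matrices); a set is closed if it contains the limits of its convergent sequences. The group $G(m,n,p)=GL(m,\mathbb{K}[[x_1,\dots,x_p]])\times GL(n,\mathbb{K}[[x_1,\dots,x_p]])$ acts on $Mat(m,n,p)$ by $(U,V).A=UAV^{-1}$. For a subgroup $G$, $G^0=\{(U,V)\in G:\pi_0U=1,\ \pi_0V=1\}$; $A,B$ are $G^0$-equivalent if $B=g.A$ for some $g\in G^0$. For $\lambda=(\lambda_l,\lambda_r)\in Mat(m,m,p)\times Mat(n,n,p)$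 with $\pi_0\lambda_l=0$, $\pi_0\lambda_r=0$, $\exp\lambda=(\exp\lambda_l,\exp\lambda_r)$ (usual exponential series). Every element of $G(m,n,p)^0$ is such an exponential. A closed subgroup $G\subset G(m,n,p)$ is called a Lie group if for every $g=\exp\lambda\in G^0$ the one-parametric group $\{\exp(t\lambda):t\in\mathbb{K}\}$ is contained in $G$. Its Lie algebra $\mathcal{L}ie(G)$ is the set of all such $\lambda$ with $\exp(t\lambda)\in G$ for all $t\in\mathbb{K}$, and $\mathcal{L}ie^{(j)}(G)=\pi^{(j)}(\mathcal{L}ie(G))\subset Mat^{(j)}(m,m,p)\times Mat^{(j)}(n,n,p)$ is its homogeneous part of degree $j$. On polynomial matrices use the inner product $\langle A,B\rangle=\sum_I I!\,\mathrm{trace}(B_I^*A_I)$, where $I!=I_1!\cdots I_p!$ and $B_I^*=\overline{B_I^T}$; on pairs, $\langle\nu,\mu\rangle=\langle\nu_l,\mu_l\rangle+\langle\nu_r,\mu_r\rangle$. For each $j$ let $\delta_j: Mat^{(j)}(m,m,p)\times Mat^{(j)}(n,n,p)\to\mathcal{L}ie^{(j)}(G)$ be the orthogonal projector; $\delta$ denotes the map on pairs of polynomial matrices acting on each homogeneous component of degree $j$ by $\delta_j$. For $B=\sum_IB_Ix^I\in Mat(m,n,p)$ put $B^*\left(\frac{\partial}{\partial x}\right)=\sum_IB_I^*\frac{\partial^{|I|}}{\partial x^I}$ and $(B^* )^T\left(\frac{\partial}{\partial x}\right)=\sum_I(B_I^* )^T\frac{\partial^{|I|}}{\partial x^I}$,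 acting on polynomial $m\times n$, respectively $n\times m$, matrices. For a polynomial $m\times n$ matrix $P$, $D_BP=(\nu_l,\nu_r)\in Mat(m,m,p)\times Mat(n,n,p)$ with $$\nu_l(x)=\left((B^* )^T\left(\tfrac{\partial}{\partial x}\right)P^T(x)\right)^T,\qquad \nu_r(x)=-B^*\left(\tfrac{\partial}{\partial x}\right)P(x).$$
   Formalization: Two hypotheses are added, without which the claim fails: K is stable under complex conjugation, and the homogeneous components of elements of Lie(G) lie in Lie(G) (it fails for G={(exp(t(x+x²)),1)}, A=1+x²). *)

(* Defs.v *)
From HB Require Import structures.
From mathcomp Require Import all_boot all_order all_algebra.
From mathcomp Require Import mpoly.
From mathcomp Require Import complex.
From mathcomp Require Import boolp classical_sets reals.

Set Implicit Arguments.
Unset Strict Implicit.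
Unset Printing Implicit Defensive.

Import GRing.Theory.
Local Open Scope classical_set_scope.
Local Open Scope ring_scope.

(* Mat(m,n,p): the matrix power series sum_I A_I x^I is the family I |-> A_I. *)
Definition fmx (K : fieldType) (p m n : nat) := 'X_{1..p} -> 'M[K]_(m, n).

(* Polynomial m x n matrices in p variables. *)
Definition pmx (K : fieldType) (p m n : nat) := 'M[{mpoly K[p]}]_(m, n).

Section FormalMatrices.
Variables (K : fieldType) (p : nat).

Definition fmul m n k (A : fmx K p m n) (B : fmx K p n k) : fmx K p m k :=
  fun I => \sum_(J : 'X_{1..p < (mdeg I).+1, (mdeg I).+1} | I == (J.1 + J.2)%MM)
             A J.1 *m B J.2.

Definition fone n : fmx K p n n := fun I => if I == 0%MM then 1%:M else 0.

Definition fscale m n (t : K) (A : fmx K p m n) : fmx K p m n :=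
  fun I => t *: A I.

Fixpoint fpow n (A : fmx K p n n) (k : nat) : fmx K p n n :=
  if k is k'.+1 then fmul A (fpow A k') else fone n.

(* When A has no constant term, A^k has no coefficient of degree < k, so that
   the terms k > |I| of the exponential series do not contribute to x^I. *)
Definition fexp n (A : fmx K p n n) : fmx K p n n :=
  fun I => \sum_(k < (mdeg I).+1) (k`!%:R)^-1 *: fpow A k I.

Definition finverse n (U V : fmx K p n n) : Prop :=
  fmul U V = fone n /\ fmul V U = fone n.

(* ptrunc j A is the part of A of degree < j, i.e. pi_{j-1} A. *)
Definition ptrunc m n (j : nat) (A : fmx K p m n) : pmx K p m n :=
  \matrix_(a, b) \sum_(I : 'X_{1..p < j}) A I a b *: 'X_[I].

Definition phomog m n (j : nat) (A : fmx K p m n) : pmx K p m n :=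
  \matrix_(a, b) \sum_(I : 'X_{1..p < j.+1} | mdeg I == j) A I a b *: 'X_[I].

(* The coefficients of P; also the embedding of polynomials into series. *)
Definition pcoef m n (P : pmx K p m n) : fmx K p m n :=
  fun I => map_mx (mcoeff I) P.

(* All coefficients of P of degree >= pmsize P vanish. *)
Definition pmsize m n (P : pmx K p m n) : nat := \max_a \max_b msize (P a b).

Definition fcvg m n (A_ : nat -> fmx K p m n) (A : fmx K p m n) : Prop :=
  forall j, exists N, forall k, (N <= k)%N -> ptrunc j (A_ k) = ptrunc j A.

(* C(d/dx) P, where d^|I|/dx^I kills P as soon as |I| >= pmsize P. *)
Definition fdiffop m n k (C : fmx K p m n) (P : pmx K p n k) : pmx K p m k :=
  \sum_(I : 'X_{1..p < pmsize P}) map_mx (@mpolyC p K) (C I) *m map_mx (mderivm I) P.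

End FormalMatrices.

Arguments fone {K p n}.

Section Groups.
Variables (K : fieldType) (m n p : nat).

Definition fpair := (fmx K p m m * fmx K p n n)%type.
Definition ppair := (pmx K p m m * pmx K p n n)%type.

Definition pair_mul (g h : fpair) : fpair := (fmul g.1 h.1, fmul g.2 h.2).
Definition pair_one : fpair := (fone, fone).
Definition pair_inverse (g h : fpair) : Prop :=
  finverse g.1 h.1 /\ finverse g.2 h.2.
Definition pair_scale (t : K) (la : fpair) : fpair :=
  (fscale t la.1, fscale t la.2).
Definition pair_exp (la : fpair) : fpair := (fexp la.1, fexp la.2).
Definition pair_cvg (g_ : nat -> fpair) (g : fpair) : Prop :=
  fcvg (fun k => (g_ k).1) g.1 /\ fcvg (fun k => (g_ k).2) g.2.
Definition pair_homog (j : nat) (la : fpair) : ppair :=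
  (phomog j la.1, phomog j la.2).
Definition pair_coef (nu : ppair) : fpair := (pcoef nu.1, pcoef nu.2).
Definition pair_no_const (la : fpair) : Prop :=
  la.1 0%MM = 0 /\ la.2 0%MM = 0.

Record closed_subgroup (G : set fpair) : Prop := ClosedSubgroup {
  csg_unit : forall g, G g -> exists h, pair_inverse g h;
  csg_one : G pair_one;
  csg_mul : forall g h, G g -> G h -> G (pair_mul g h);
  csg_inv : forall g h, G g -> pair_inverse g h -> G h;
  csg_closed : forall g_ g, (forall k, G (g_ k)) -> pair_cvg g_ g -> G g }.

Definition unipotent_part (G : set fpair) : set fpair :=
  [set g | G g /\ g.1 0%MM = 1%:M /\ g.2 0%MM = 1%:M].

Definition formal_lie_group (G : set fpair) : Prop :=
  closed_subgroup G /\
  forall la, pair_no_const la -> unipotent_part G (pair_exp la) ->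
    forall t : K, G (pair_exp (pair_scale t la)).

Definition Lie (G : set fpair) : set fpair :=
  [set la | pair_no_const la /\ forall t : K, G (pair_exp (pair_scale t la))].

Definition Lie_homog (G : set fpair) (j : nat) : set ppair :=
  [set pair_homog j la | la in Lie G].

(* Lie_homog G j is the homogeneous part of degree j of Lie G, i.e. it is
   contained in Lie G. This does not follow from formal_lie_group: for
   m = n = p = 1, the group of all (exp(t(x + x^2)), 1) is a formal Lie group. *)
Definition homogeneous_Lie (G : set fpair) : Prop :=
  forall j nu, Lie_homog G j nu -> Lie G (pair_coef nu).

(* B = U A V^-1 with (U, V) in G^0. *)
Definition unipotent_equiv (G : set fpair) (A B : fmx K p m n) : Prop :=
  exists g h, unipotent_part G g /\ pair_inverse g h /\
    B = fmul (fmul g.1 A) h.2.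

End Groups.

Section Conjugation.
Variables (K : fieldType) (cj : K -> K) (p : nat).

Definition adjmx m n (M : 'M[K]_(m, n)) : 'M[K]_(n, m) := map_mx cj M^T.

Definition fadj m n (B : fmx K p m n) : fmx K p n m := fun I => adjmx (B I).

Definition fadjT m n (B : fmx K p m n) : fmx K p m n :=
  fun I => (adjmx (B I))^T.

Definition mfact (I : 'X_{1..p}) : nat := (\prod_(i < p) (I i)`!)%N.

Definition pinner m n (A B : pmx K p m n) : K :=
  \sum_(I : 'X_{1..p < maxn (pmsize A) (pmsize B)})
    (mfact I)%:R * \tr (adjmx (pcoef B I) *m pcoef A I).

Variables (m n : nat).

Definition pair_inner (nu mu : ppair K m n p) : K :=
  pinner nu.1 mu.1 + pinner nu.2 mu.2.

(* The value at nu of the orthogonal projector onto Lie_homog G j, selected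
   among the mu in Lie_homog G j such that nu - mu is orthogonal to it. *)
Definition delta_homog (G : set (fpair K m n p)) (j : nat) (nu : ppair K m n p)
    : ppair K m n p :=
  xget 0 [set mu | Lie_homog G j mu /\
    forall ka, Lie_homog G j ka -> pair_inner (nu - mu) ka = 0].

Definition delta (G : set (fpair K m n p)) (nu : ppair K m n p) :
    ppair K m n p :=
  \sum_(j < maxn (pmsize nu.1) (pmsize nu.2))
    delta_homog G j (pair_homog j (pair_coef nu)).

Definition Dop (B : fmx K p m n) (P : pmx K p m n) : ppair K m n p :=
  ((fdiffop (fadjT B) P^T)^T, - fdiffop (fadj B) P).

End Conjugation.

(* Main.v *)
Require Import Defs.
From mathcomp Require Import all_boot all_order all_algebra.
From mathcomp Require Import ssrcomplements mpoly.
From mathcomp Require Import complex.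
From mathcomp Require Import boolp classical_sets functions reals.
From mathcomp Require Import zify.

(** An element la of the Lie algebra acts on B by la_l B - B la_r ([bracket]),
the tangent vector at B of the orbit, and D_B is the adjoint of this action
([pair_inner_Dop]). So the equations for B^(j) say that, for some matrix f_j of
degree less than j, B^(j) - f_j is orthogonal to the tangent space at B. By
linear algebra in finite dimension ([orthogonal_of_capv]), such an f_j exists
exactly when B^(j) is orthogonal to those tangent vectors whose part of degree
less than j vanishes ([normal_atP]). This condition involves only the part of B
of degree at most j, which makes an induction on the degree possible.

The link between group and Lie algebra is that, for g = exp la, the series g_l
B - B g_r and la_l B - B la_r have the same leading part ([fexp_intertwine]).

Uniqueness ([normal_unique]). Let C = g.B with both B and C normal, and assume
that they agree below degree j. Then C^(j) - B^(j) is the degree j part of a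
tangent vector without lower part. Both B^(j) and C^(j) are orthogonal to it,
hence so is their difference, which vanishes as the inner product is definite:
K is a field of complex numbers.

Existence. The degree j part of A is made normal by subtracting its orthogonal
projection on the space of tangent vectors without lower part, that is, up to
higher degrees, by applying some exp la ([normal_step]). By uniqueness the
matrices obtained in this way converge, but the group elements need not. Their
limit B is in the closure of the orbit, and orbits are closed ([orbit_closed]),
by a Mittag-Leffler argument: the logarithms that fix A modulo degree d form a
decreasing sequence of subspaces, whose images in each finite-dimensional
truncation become constant.

All this needs the Lie algebra to be a vector space that contains each series
whose homogeneous parts come from it ([Lie_of_comps], [LieD]). That follows
from the homogeneity of the Lie algebra, by approximating an exponential in the
group degree by degree. *)

Set Implicit Arguments.
Unset Strict Implicit.
Unset Printing Implicit Defensive.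

Import GRing.Theory.
Local Open Scope ring_scope.

(** * Congruences and products of matrix power series *)

Section Series.
Variables (K : fieldType) (p : nat).

(** Congruence modulo the d-th power of the maximal ideal of the power series.
*)
Definition eqd m n d (A B : fmx K p m n) :=
  forall I : 'X_{1..p}, (mdeg I < d)%N -> A I = B I.

Section Congruence.
Variables m n : nat.
Implicit Types A B C : fmx K p m n.

Lemma eqd_refl d A : eqd d A A.
Proof. by []. Qed.

Lemma eqd_sym d A B : eqd d A B -> eqd d B A.
Proof. by move=> AB I lt_I; rewrite AB. Qed.

Lemma eqd_trans d A B C : eqd d A B -> eqd d B C -> eqd d A C.
Proof. by move=> AB BC I lt_I; rewrite AB // BC. Qed.

Lemma eqd_le d d' A B : (d' <= d)%N -> eqd d A B -> eqd d' A B.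
Proof. by move=> le_d AB I lt_I; apply: AB; apply: leq_trans le_d. Qed.

Lemma eqd0 A B : eqd 0 A B.
Proof. by []. Qed.

Lemma eqdP A B : (forall d, eqd d A B) -> A = B.
Proof. by move=> AB; apply/funext => I; apply: (AB (mdeg I).+1). Qed.

Lemma eqdD d A A' B B' : eqd d A A' -> eqd d B B' -> eqd d (A + B) (A' + B').
Proof. by move=> AA BB I lt_I; rewrite /GRing.add /= AA // BB. Qed.

Lemma eqdN d A A' : eqd d A A' -> eqd d (- A) (- A').
Proof. by move=> AA I lt_I; rewrite /GRing.opp /= AA. Qed.

Lemma eqdB d A A' B B' : eqd d A A' -> eqd d B B' -> eqd d (A - B) (A' - B').
Proof. by move=> AA BB; apply: eqdD => //; apply: eqdN. Qed.

Lemma eqdZ d t A A' : eqd d A A' -> eqd d (t *: A) (t *: A').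
Proof. by move=> AA I lt_I; rewrite /GRing.scale /= AA. Qed.

Lemma eqd_sum d k (F F' : 'I_k -> fmx K p m n) :
  (forall i, eqd d (F i) (F' i)) -> eqd d (\sum_i F i) (\sum_i F' i).
Proof.
by move=> FF; elim/big_ind2: _ => // *; apply: eqdD.
Qed.

Lemma eqd_sub0 d A B : eqd d (A - B) 0 <-> eqd d A B.
Proof.
split=> AB I /AB; first by move/eqP; rewrite subr_eq0 => /eqP.
by move=> AIB; rewrite /GRing.add /GRing.opp /= AIB subrr.
Qed.

Lemma eqd1 A B : A 0%MM = B 0%MM -> eqd 1 A B.
Proof. by move=> AB I; rewrite ltnS leqn0 mdeg_eq0 => /eqP->. Qed.

(** A coherent family has a limit, whose coefficient at x^I is read off from
the first member that is already exact there. *)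
Lemma eqd_limit (A_ : nat -> fmx K p m n) :
  (forall d, eqd d (A_ d) (A_ d.+1)) -> exists A, forall d, eqd d A (A_ d).
Proof.
move=> coh; exists (fun I => A_ (mdeg I).+1 I) => d I lt_I /=.
rewrite -(subnK lt_I); elim: (d - _)%N => // k ->.
by rewrite addSn coh // ltn_addl.
Qed.

End Congruence.

Section Product.
Variables m n k : nat.
Implicit Types (A : fmx K p m n) (B : fmx K p n k).

Lemma fmulDl A A' B : fmul (A + A') B = fmul A B + fmul A' B.
Proof.
apply/funext => I; rewrite {2}/GRing.add /= /fmul -big_split /=.
by apply: eq_bigr => J _; rewrite mulmxDl.
Qed.

Lemma fmulDr A B B' : fmul A (B + B') = fmul A B + fmul A B'.
Proof.
apply/funext => I; rewrite {2}/GRing.add /= /fmul -big_split /=.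
by apply: eq_bigr => J _; rewrite mulmxDr.
Qed.

Lemma fmulZl t A B : fmul (t *: A) B = t *: fmul A B.
Proof.
apply/funext => I; rewrite {2}/GRing.scale /= /fmul scaler_sumr /=.
by apply: eq_bigr => J _; rewrite scalemxAl.
Qed.

Lemma fmulZr t A B : fmul A (t *: B) = t *: fmul A B.
Proof.
apply/funext => I; rewrite {2}/GRing.scale /= /fmul scaler_sumr /=.
by apply: eq_bigr => J _; rewrite scalemxAr.
Qed.

Lemma fmulNl A B : fmul (- A) B = - fmul A B.
Proof. by rewrite -scaleN1r fmulZl scaleN1r. Qed.

Lemma fmulNr A B : fmul A (- B) = - fmul A B.
Proof. by rewrite -scaleN1r fmulZr scaleN1r. Qed.

Lemma fmulBl A A' B : fmul (A - A') B = fmul A B - fmul A' B.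
Proof. by rewrite fmulDl fmulNl. Qed.

Lemma fmulBr A B B' : fmul A (B - B') = fmul A B - fmul A B'.
Proof. by rewrite fmulDr fmulNr. Qed.

Lemma fmul0 A : fmul A (0 : fmx K p n k) = 0.
Proof. by rewrite -(scale0r (0 : fmx K p n k)) fmulZr scale0r. Qed.

Lemma f0mul B : fmul (0 : fmx K p m n) B = 0.
Proof. by rewrite -(scale0r (0 : fmx K p m n)) fmulZl scale0r. Qed.

Lemma fmul_suml N (F : 'I_N -> fmx K p m n) B :
  fmul (\sum_i F i) B = \sum_i fmul (F i) B.
Proof.
by elim/big_ind2: _ => [|x1 x2 y1 y2 <- <-|//]; rewrite ?f0mul ?fmulDl.
Qed.

Lemma fmul_sumr N A (F : 'I_N -> fmx K p n k) :
  fmul A (\sum_i F i) = \sum_i fmul A (F i).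
Proof.
by elim/big_ind2: _ => [|x1 x2 y1 y2 <- <-|//]; rewrite ?fmul0 ?fmulDr.
Qed.

Lemma eqd_fmul d A A' B B' :
  eqd d A A' -> eqd d B B' -> eqd d (fmul A B) (fmul A' B').
Proof.
move=> AA BB I lt_I; apply: eq_bigr => -[[J1 ?] [J2 ?]] /= /eqP defI.
by have:= lt_I; rewrite defI mdegD => lt_J; rewrite AA ?BB //; lia.
Qed.

(** Orders of vanishing add up, as every term of the product at x^I splits I.
*)
Lemma eqd_fmul_gr a b A B :
  eqd a A 0 -> eqd b B 0 -> eqd (a + b) (fmul A B) 0.
Proof.
move=> A0 B0 I lt_I; apply: big1 => -[[J1 ?] [J2 ?]] /= /eqP defI.
have:= lt_I; rewrite defI mdegD => lt_J.
have [/A0->|le_a] := ltnP (mdeg J1) a; first by rewrite mul0mx.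
by rewrite B0 ?mulmx0 //; lia.
Qed.

End Product.

Lemma pcoef_inj m n : injective (@pcoef K p m n).
Proof.
move=> P Q PQ; apply/matrixP => a b; apply/mpolyP => I.
by have /matrixP /(_ a b) := congr1 (fun A => A I) PQ; rewrite !mxE.
Qed.

Lemma pcoef_ptrunc m n d (A : fmx K p m n) I :
  pcoef (ptrunc d A) I = if (mdeg I < d)%N then A I else 0.
Proof.
apply/matrixP => a b; rewrite !mxE raddf_sum /=.
under eq_bigr => J _ do rewrite mcoeffZ mcoeffX.
case: ifPn => [lt_I|ge_I].
  rewrite (bigD1 (BMultinom lt_I)) //= eqxx mulr1 big1 ?addr0 // => J.
  by rewrite bmeqP /= => /negbTE->; rewrite mulr0.
rewrite mxE big1 // => J _; case: eqP => [defI|_]; last by rewrite mulr0.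
by rewrite -defI bmdeg in ge_I.
Qed.

Lemma pcoef_phomog m n d (A : fmx K p m n) I :
  pcoef (phomog d A) I = if mdeg I == d then A I else 0.
Proof.
apply/matrixP => a b; rewrite !mxE raddf_sum /=.
under eq_bigr => J _ do rewrite mcoeffZ mcoeffX.
case: ifPn => [/eqP degI|neq_I].
  have lt_I : (mdeg I < d.+1)%N by rewrite degI.
  rewrite (bigD1 (BMultinom lt_I)) /= ?degI ?eqxx // mulr1 big1 ?addr0 // => J.
  by rewrite bmeqP /= => /andP [_ /negbTE->]; rewrite mulr0.
rewrite mxE big1 // => J degJ; case: eqP => [defI|_]; last by rewrite mulr0.
by rewrite -defI degJ in neq_I.
Qed.

Lemma eqd_ptrunc m n d (A : fmx K p m n) : eqd d A (pcoef (ptrunc d A)).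
Proof. by move=> I lt_I; rewrite pcoef_ptrunc lt_I. Qed.

Lemma ptrunc_eqd m n d (A B : fmx K p m n) :
  ptrunc d A = ptrunc d B <-> eqd d A B.
Proof.
split=> [AB | AB].
  by apply: eqd_trans (eqd_ptrunc A) _; rewrite AB; apply/eqd_sym/eqd_ptrunc.
apply: pcoef_inj; apply/funext => I; rewrite !pcoef_ptrunc.
by case: ifP => // /AB.
Qed.

Lemma pcoef_mul m n k (P : pmx K p m n) (Q : pmx K p n k) :
  pcoef (P *m Q) = fmul (pcoef P) (pcoef Q).
Proof.
apply/funext => I; apply/matrixP => a b; rewrite !mxE raddf_sum /= summxE.
under eq_bigr => c _ do rewrite mcoeffM.
rewrite exchange_big /=; apply: eq_bigr => J _; rewrite mxE.
by apply: eq_bigr => c _; rewrite !mxE.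
Qed.

(** Both sides are determined modulo degree d by the truncations of the
factors, where associativity is that of polynomial matrices. *)
Lemma fmulA m n k l (A : fmx K p m n) (B : fmx K p n k) (C : fmx K p k l) :
  fmul A (fmul B C) = fmul (fmul A B) C.
Proof.
apply: eqdP => d.
have truncE m' n' (X : fmx K p m' n') := @eqd_ptrunc m' n' d X.
apply: eqd_trans (eqd_fmul (truncE _ _ A) (eqd_fmul (truncE _ _ B) (truncE _ _
  C))) _.
apply: eqd_sym.
apply: eqd_trans (eqd_fmul (eqd_fmul (truncE _ _ A) (truncE _ _ B)) (truncE _ _
  C)) _.
by rewrite -!pcoef_mul mulmxA.
Qed.

Lemma fone_pcoef n : fone = pcoef (1%:M : pmx K p n n).
Proof.
apply/funext => I; apply/matrixP => a b; rewrite /fone !mxE.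
case: eqVneq => [->|nz_I]; rewrite !mxE; case: (a == b); rewrite ?mcoeff0 //.
  by rewrite mcoeff1 eqxx.
by rewrite mcoeff1 (negbTE nz_I).
Qed.

Lemma f1mul m n (A : fmx K p m n) : fmul fone A = A.
Proof.
apply: eqdP => d; rewrite fone_pcoef.
apply: eqd_trans (eqd_fmul (@eqd_refl _ _ d _) (@eqd_ptrunc _ _ d A)) _.
by rewrite -pcoef_mul mul1mx; apply/eqd_sym/eqd_ptrunc.
Qed.

Lemma fmul1 m n (A : fmx K p m n) : fmul A fone = A.
Proof.
apply: eqdP => d; rewrite fone_pcoef.
apply: eqd_trans (eqd_fmul (@eqd_ptrunc _ _ d A) (@eqd_refl _ _ d _)) _.
by rewrite -pcoef_mul mulmx1; apply/eqd_sym/eqd_ptrunc.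
Qed.

End Series.

(** * The exponential *)

Section Exponential.
Variables (K : fieldType) (p : nat).

Section Square.
Variable n : nat.
Implicit Types X Y M U : fmx K p n n.

Lemma fpow_gr X k : eqd 1 X 0 -> eqd k (fpow X k) 0.
Proof. by move=> X0; elim: k => // k; rewrite -add1n; apply: eqd_fmul_gr. Qed.

(** The difference of the powers is a sum of products of k.+1 factors, at least
one of which is M while the others have no constant term. *)
Lemma fpowD X M d k : (0 < d)%N -> eqd 1 X 0 -> eqd d M 0 ->
  eqd (d + k) (fpow (X + M) k.+1) (fpow X k.+1).
Proof.
move=> d_gt0 X0 M0.
have XM0 : eqd 1 (X + M) 0.
  by rewrite -(addr0 0); apply: eqdD => //; apply: eqd_le M0.
elim: k => [|k IHk]; first by rewrite addn0 /= !fmul1 -eqd_sub0 addrAC subrr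
  add0r.
rewrite -eqd_sub0 [fpow _ _]/= [fpow X _]/= -!/(fpow _ k.+1).
rewrite fmulDl addrAC -fmulBr -(addr0 0); apply: eqdD.
  by rewrite -add1n addnCA; apply: eqd_fmul_gr => //; rewrite eqd_sub0.
by apply: eqd_fmul_gr => //; apply: fpow_gr.
Qed.

Lemma fexp_series N X : eqd 1 X 0 ->
  eqd N (fexp X) (\sum_(k < N) (k`!%:R)^-1 *: fpow X k).
Proof.
move=> X0 I lt_I; rewrite fct_sumE /fexp.
rewrite (big_ord_widen _ (fun k => (k`!%:R)^-1 *: fpow X k I) lt_I) big_mkcond.
apply: eq_bigr => k _; rewrite {2}/GRing.scale /=; case: ifPn => //.
by rewrite -leqNgt => lt_k; rewrite (fpow_gr X0) // scaler0.
Qed.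

Lemma fexp_const X : fexp X 0%MM = 1%:M.
Proof.
rewrite /fexp mdeg0 big_ord_recl big_ord0 addr0 /= /fone eqxx fact0 invr1.
by rewrite scale1r.
Qed.

Lemma fexp0 : fexp 0 = fone :> fmx K p n n.
Proof.
apply/funext => I; rewrite /fexp big_ord_recl fact0 invr1 scale1r.
by rewrite big1 ?addr0 // => k _ /=; rewrite f0mul scaler0.
Qed.

(** Only the linear term of the exponential series sees M in degree d. *)
Lemma fexpD X M d : (0 < d)%N -> eqd 1 X 0 -> eqd d M 0 ->
  eqd d.+1 (fexp (X + M)) (fexp X + M).
Proof.
case: d => // d d_gt0 X0 M0.
have XM0 : eqd 1 (X + M) 0.
  by rewrite -(addr0 0); apply: eqdD => //; apply: eqd_le M0.
(* Modulo degree d.+2, only the term of exponent 1 of the series depends on M. *)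
apply: eqd_trans (fexp_series XM0) _.
apply: eqd_trans (eqd_sym (eqdD (fexp_series X0) (@eqd_refl _ _ _ _ _ M))).
rewrite 2!big_ord_recl [X in eqd _ _ (X + M)]big_ord_recl.
rewrite [X in eqd _ _ (_ + X + M)]big_ord_recl /= !fmul1 invr1 !scale1r.
rewrite -[X in eqd _ _ X]addrA [X in eqd _ _ (_ + X)]addrAC.
do 2 apply: eqdD => //; apply: eqd_sum => i; apply: eqdZ.
by apply: (@eqd_le _ _ _ _ (d.+1 + i.+1)); [lia | apply: fpowD].
Qed.

(** By induction on d: if X and Y agree below degree d, then by [fexpD] their
exponentials differ in degree d by the difference of X and Y. *)
Lemma fexp_eqd d X Y : eqd 1 X 0 -> eqd 1 Y 0 ->
  eqd d (fexp X) (fexp Y) <-> eqd d X Y.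
Proof.
move=> X0 Y0; elim: d => [|[|d] IHd]; first by split=> _; apply: eqd0.
  split=> _; first by apply: eqd_trans X0 (eqd_sym Y0).
  by apply: eqd1; rewrite !fexp_const.
have diffE : eqd d.+1 X Y -> eqd d.+2 (fexp X - fexp Y) (X - Y).
  move=> /eqd_sub0 XY; have := fexpD (ltn0Sn d) Y0 XY.
  rewrite [Y + _]addrC subrK => /eqdB/(_ (@eqd_refl _ _ _ _ d.+2 (fexp Y))).
  by rewrite [fexp Y + _]addrC addrK.
split=> XY; have /diffE XYd : eqd d.+1 X Y.
- by apply/IHd; apply: eqd_le XY.
- by apply/eqd_sub0; apply: eqd_trans (eqd_sym XYd) _; apply/eqd_sub0.
- by apply: eqd_le XY.
- by apply/eqd_sub0; apply: eqd_trans XYd _; apply/eqd_sub0.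
Qed.

Lemma fexp_mul X M d : (0 < d)%N -> eqd 1 X 0 -> eqd d M 0 ->
  eqd d.+1 (fmul (fexp X) (fexp M)) (fexp (X + M)).
Proof.
move=> d_gt0 X0 M0; apply: eqd_trans (eqd_sym (fexpD d_gt0 X0 M0)).
have expM : eqd d.+1 (fexp M) (fone + M).
  by have := @fexpD 0 M d d_gt0 (@eqd_refl _ _ _ _ _ _) M0; rewrite fexp0 add0r.
apply: eqd_trans (eqd_fmul (@eqd_refl _ _ _ _ _ _) expM) _.
rewrite fmulDr fmul1; apply: eqdD => //; apply/eqd_sub0.
rewrite -[M in _ - M]f1mul -fmulBl -add1n; apply: eqd_fmul_gr => //.
by apply/eqd_sub0/eqd1; rewrite fexp_const /fone eqxx.
Qed.

(** The logarithm is built degree by degree: by [fexpD] the error of the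
exponential of an approximate logarithm is a correction for the latter;
injectivity of the exponential makes the approximations coherent. *)
Lemma flog U : U 0%MM = 1%:M -> exists2 X, eqd 1 X 0 & fexp X = U.
Proof.
move=> U0.
have approx d : exists X, eqd 1 X 0 /\ eqd d.+1 (fexp X) U.
  elim: d => [|d [X [X0 XU]]].
    by exists 0; split=> //; apply: eqd1; rewrite fexp_const.
  have M0 : eqd d.+1 (U - fexp X) 0 by apply/eqd_sub0/eqd_sym.
  exists (X + (U - fexp X)); split.
    by rewrite -(addr0 0); apply: eqdD => //; apply: eqd_le M0.
  by have := fexpD (ltn0Sn d) X0 M0; rewrite [fexp X + _]addrC subrK.
have [X_ X_E] := choice approx.
have [|X XE] := @eqd_limit _ _ _ _ X_.
  move=> d; apply: (@eqd_le _ _ _ _ d.+1) => //.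
  have [X0 XU] := X_E d; have [X0' XU'] := X_E d.+1.
  rewrite -fexp_eqd //; apply: eqd_trans XU (eqd_sym _).
  by apply: eqd_le XU'.
have X0 : eqd 1 X 0 by apply: eqd_trans (XE 1%N) _; case: (X_E 1%N).
exists X => //; apply: eqdP => d; have [X0' XU] := X_E d.
apply: eqd_trans (eqd_le _ XU) => //.
by rewrite fexp_eqd.
Qed.

End Square.

(** Put N = X A - A Y. Then X^k A - A Y^k is the sum of the X^a N Y^b with a +
b = k - 1, so that it has higher order than N as soon as k > 1 and only the
linear terms of the two exponentials contribute to the leading part. *)
Lemma fexp_intertwine m n d (X : fmx K p m m) (Y : fmx K p n n) A :
  eqd 1 X 0 -> eqd 1 Y 0 -> eqd d (fmul X A - fmul A Y) 0 ->
  eqd d.+1 (fmul (fexp X) A - fmul A (fexp Y)) (fmul X A - fmul A Y).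
Proof.
move=> X0 Y0 N0; set N := fmul X A - _.
have powE k : eqd (d + k) (fmul (fpow X k.+1) A - fmul A (fpow Y k.+1)) 0.
  elim: k => [|k IHk]; first by rewrite addn0 /= !fmul1.
  rewrite [fpow _ _]/= [fpow Y _]/= -!/(fpow _ k.+1).
  have -> : fmul (fmul X (fpow X k.+1)) A - fmul A (fmul Y (fpow Y k.+1)) =
     fmul X (fmul (fpow X k.+1) A - fmul A (fpow Y k.+1)) + fmul N (fpow Y
       k.+1).
    by rewrite fmulBr /N fmulBl !fmulA addrA subrK.
  rewrite -(addr0 0); apply: eqdD.
    by rewrite -add1n addnCA; apply: eqd_fmul_gr.
  by apply: eqd_fmul_gr => //; apply: fpow_gr.
apply: eqd_trans (_ : eqd _ _ (\sum_(k < d.+2)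
    (k`!%:R)^-1 *: (fmul (fpow X k) A - fmul A (fpow Y k)))) _.
  apply: eqd_trans (eqdB (eqd_fmul (eqd_le _ (@fexp_series _ d.+2 _ X0)) _)
    (eqd_fmul _ (eqd_le _ (@fexp_series _ d.+2 _ Y0)))) _ => //.
  rewrite fmul_suml fmul_sumr -sumrB => I _; congr (_ I).
  by apply: eq_bigr => k _; rewrite fmulZl fmulZr scalerBr.
rewrite 2!big_ord_recl /= f1mul !fmul1 subrr scaler0 add0r invr1 scale1r.
rewrite -[X in eqd _ _ X]addr0; apply: eqdD => //.
elim/big_ind: _ => // [Z1 Z2 Z10 Z20|k _]; first by rewrite -(addr0 0);
  apply: eqdD.
have kill : eqd d.+1 (fmul (fpow X k.+2) A - fmul A (fpow Y k.+2)) 0.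
  by apply: (@eqd_le _ _ _ _ (d + k.+1)); [lia | apply: powE].
by have := eqdZ ((bump 0 (bump 0 k))`!%:R^-1) kill; rewrite scaler0.
Qed.

End Exponential.

(** * Pairs of matrix power series *)

Section Pairs.
Variables (K : fieldType) (m n p : nat).
Implicit Types g h la mu : fpair K m n p.
Local Notation one := (pair_one K m n p).

Definition peqd d g h := eqd d g.1 h.1 /\ eqd d g.2 h.2.

Lemma peqd_sym d g h : peqd d g h -> peqd d h g.
Proof. by case=> *; split; apply: eqd_sym. Qed.

Lemma peqd_trans d g h k : peqd d g h -> peqd d h k -> peqd d g k.
Proof. by move=> [? ?] [? ?]; split; apply: eqd_trans; eassumption. Qed.

Lemma peqd_le d d' g h : (d' <= d)%N -> peqd d g h -> peqd d' g h.
Proof. by move=> le_d [? ?]; split; apply: eqd_le; eassumption. Qed.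

Lemma peqdP g h : (forall d, peqd d g h) -> g = h.
Proof.
case: g h => [g1 g2] [h1 h2] gh; congr pair; apply: eqdP => d; by case: (gh d).
Qed.

Lemma peqdD d g g' h h' : peqd d g g' -> peqd d h h' ->
  peqd d (g + h) (g' + h').
Proof. by move=> [? ?] [? ?]; split; apply: eqdD. Qed.

Lemma peqd_sub0 d g h : peqd d (g - h) 0 <-> peqd d g h.
Proof. by split=> -[/eqd_sub0 ? /eqd_sub0 ?]; split => //; apply/eqd_sub0. Qed.

Lemma peqd_mul d g g' h h' :
  peqd d g g' -> peqd d h h' -> peqd d (pair_mul g h) (pair_mul g' h').
Proof. by move=> [? ?] [? ?]; split; apply: eqd_fmul. Qed.

Lemma pair_no_constE la : pair_no_const la <-> peqd 1 la 0.
Proof.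
split=> -[la1 la2]; first by split; apply: eqd1.
by split; [rewrite la1|rewrite la2]; rewrite ?mdeg0.
Qed.

Lemma pair_mulA g h k : pair_mul g (pair_mul h k) = pair_mul (pair_mul g h) k.
Proof. by rewrite /pair_mul /= !fmulA. Qed.

Lemma pair_mul1 g : pair_mul g one = g.
Proof. by case: g => g1 g2; rewrite /pair_mul /= !fmul1. Qed.

Lemma pair_1mul g : pair_mul one g = g.
Proof. by case: g => g1 g2; rewrite /pair_mul /= !f1mul. Qed.

Lemma pair_mulV g h : pair_inverse g h -> pair_mul g h = one.
Proof. by case: g h => [? ?] [? ?] [[/= gh1 _] [/= gh2 _]]; congr pair. Qed.

Lemma pair_mulVr g h : pair_inverse g h -> pair_mul h g = one.
Proof. by case: g h => [? ?] [? ?] [[/= _ gh1] [/= _ gh2]]; congr pair. Qed.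

Lemma pair_exp0 : pair_exp (0 : fpair K m n p) = one.
Proof. by rewrite /pair_exp !fexp0. Qed.

Lemma pair_exp_peqd d la mu : peqd 1 la 0 -> peqd 1 mu 0 ->
  peqd d (pair_exp la) (pair_exp mu) <-> peqd d la mu.
Proof.
move=> [la1 la2] [mu1 mu2].
by split=> -[H1 H2]; split; move: H1 H2; rewrite !fexp_eqd.
Qed.

Lemma pair_log g : peqd 1 g one ->
  exists2 la, peqd 1 la 0 & pair_exp la = g.
Proof.
case: g => g1 g2 [/= g1E g2E].
have unit n' : (fone : fmx K p n' n') 0%MM = 1%:M by rewrite /fone eqxx.
have [|la1 la10 <-] := @flog _ _ _ g1; first by rewrite g1E ?mdeg0.
have [|la2 la20 <-] := @flog _ _ _ g2; first by rewrite g2E ?mdeg0.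
by exists (la1, la2).
Qed.

Lemma pair_exp_one la : peqd 1 (pair_exp la) one.
Proof. by split; apply: eqd1; rewrite /= fexp_const /fone eqxx. Qed.

Lemma pair_exp_mul d la mu : (0 < d)%N -> peqd 1 la 0 -> peqd d mu 0 ->
  peqd d.+1 (pair_mul (pair_exp la) (pair_exp mu)) (pair_exp (la + mu)).
Proof. by move=> d_gt0 [? ?] [? ?]; split; apply: fexp_mul. Qed.

Definition pair_comp j la : fpair K m n p := pair_coef (pair_homog j la).

Lemma pair_comp1 j la I :
  (pair_comp j la).1 I = if mdeg I == j then la.1 I else 0.
Proof. exact: pcoef_phomog. Qed.

Lemma pair_comp2 j la I :
  (pair_comp j la).2 I = if mdeg I == j then la.2 I else 0.
Proof. exact: pcoef_phomog. Qed.

Lemma pair_ext g h :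
  (forall I, g.1 I = h.1 I) -> (forall I, g.2 I = h.2 I) -> g = h.
Proof. by case: g h => [? ?] [? ?] /= /funext -> /funext ->. Qed.

Lemma pair_coefD la mu I : (la + mu).1 I = la.1 I + mu.1 I.
Proof. by []. Qed.

Lemma pair_coefD2 la mu I : (la + mu).2 I = la.2 I + mu.2 I.
Proof. by []. Qed.

Lemma pair_coefZ t la I : (t *: la).1 I = t *: la.1 I.
Proof. by []. Qed.

Lemma pair_coefZ2 t la I : (t *: la).2 I = t *: la.2 I.
Proof. by []. Qed.

Definition pair_coefE := (pair_coefD, pair_coefD2, pair_coefZ, pair_coefZ2).

Lemma pair_compD j la mu : pair_comp j (la + mu) = pair_comp j la + pair_comp j
  mu.
Proof.
apply: pair_ext => I; rewrite pair_coefE !(pair_comp1, pair_comp2) pair_coefE;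
  by case: ifP; rewrite ?addr0.
Qed.

Lemma pair_compZ j t la : pair_comp j (t *: la) = t *: pair_comp j la.
Proof.
apply: pair_ext => I; rewrite pair_coefE !(pair_comp1, pair_comp2) pair_coefE;
  by case: ifP; rewrite ?scaler0.
Qed.

Lemma pair_comp_id j la : pair_comp j (pair_comp j la) = pair_comp j la.
Proof.
by apply: pair_ext => I; rewrite !(pair_comp1, pair_comp2); case: eqP.
Qed.

Lemma pair_comp_gr j la : peqd j (pair_comp j la) 0.
Proof.
by split=> I lt_I; rewrite !(pair_comp1, pair_comp2) (ltn_eqF lt_I).
Qed.

Lemma pair_comp_peqd j la mu :
  peqd j.+1 la mu -> pair_comp j la = pair_comp j mu.
Proof.
move=> [eq1 eq2]; apply: pair_ext => I; rewrite !(pair_comp1, pair_comp2);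
  by case: eqP => // degI; rewrite ?eq1 ?eq2 ?degI.
Qed.

Lemma peqd_comp j la : peqd j la 0 -> peqd j.+1 la (pair_comp j la).
Proof.
move=> [eq1 eq2]; split=> I; rewrite !(pair_comp1, pair_comp2) ltnS leq_eqVlt;
  by case: eqP => //= _ ltI; rewrite ?eq1 ?eq2.
Qed.

End Pairs.

(** * The Lie algebra of a formal Lie group *)

Section LieAlgebra.
Variables (K : fieldType) (m n p : nat) (G : set (fpair K m n p)).
Hypotheses (lieG : formal_lie_group G) (homG : homogeneous_Lie G).
Implicit Types g h la mu ka : fpair K m n p.

Local Notation one := (pair_one K m n p).

Lemma unipotent_partE g : unipotent_part G g <-> G g /\ peqd 1 g one.
Proof.
have unit n' : (fone : fmx K p n' n') 0%MM = 1%:M by rewrite /fone eqxx.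
split=> [[Gg [g1 g2]] | [Gg [g1 g2]]].
  by split=> //; split; apply: eqd1; rewrite (g1, g2) /= unit.
by split=> //; split; rewrite (g1, g2) ?mdeg0 //= unit.
Qed.

Lemma unipotent_one : unipotent_part G one.
Proof. by rewrite unipotent_partE; split=> //; apply: csg_one; case: lieG. Qed.

Lemma unipotent_mul g h :
  unipotent_part G g -> unipotent_part G h -> unipotent_part G (pair_mul g h).
Proof.
rewrite !unipotent_partE => -[Gg g1] [Gh h1]; split.
  by apply: csg_mul => //; case: lieG.
by rewrite -[one]pair_mul1; apply: peqd_mul.
Qed.

Lemma unipotent_inv g :
  unipotent_part G g -> exists2 h, unipotent_part G h & pair_inverse g h.
Proof.
rewrite unipotent_partE => -[Gg g1]; have [csG _] := lieG.
have [h gh] := csg_unit csG Gg; exists h => //.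
rewrite unipotent_partE; split; first exact: csg_inv csG _ _ Gg gh.
rewrite -(pair_mulV gh) -[X in peqd _ X _]pair_1mul.
by apply: peqd_mul => //; apply: peqd_sym.
Qed.

Lemma Lie_no_const la : Lie G la -> peqd 1 la 0.
Proof. by case=> /pair_no_constE. Qed.

Lemma Lie_exp la : Lie G la -> unipotent_part G (pair_exp la).
Proof.
move=> [la0 Gla]; rewrite unipotent_partE; split; last exact: pair_exp_one.
by rewrite -(scale1r la); apply: Gla.
Qed.

Lemma unipotent_log g :
  unipotent_part G g -> exists2 la, Lie G la & pair_exp la = g.
Proof.
move=> Gg; have /unipotent_partE [_ /pair_log [la la0 laE]] := Gg.
exists la => //; split; first exact/pair_no_constE.
by apply: (proj2 lieG); rewrite ?laE //; apply/pair_no_constE.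
Qed.

Lemma LieZ t la : Lie G la -> Lie G (t *: la).
Proof.
move=> [/pair_no_constE [la1 la2] Gla]; split.
  by apply/pair_no_constE; rewrite -(scaler0 _ t); split; apply: eqdZ.
by move=> s; have := Gla (s * t); rewrite -[pair_scale _ _]/((s * t) *: la)
  -scalerA.
Qed.

Lemma Lie_comp j la : Lie G la -> Lie G (pair_comp j la).
Proof. by move=> Gla; apply: (homG (j := j)); exists la. Qed.

(** The logarithm of exp la * exp mu starts in degree j with la + mu, so that
this sum is a homogeneous part of an element of the Lie algebra. *)
Lemma Lie_compD j la mu :
  Lie G la -> Lie G mu -> Lie G (pair_comp j (la + mu)).
Proof.
move=> Gla Gmu; case: j => [|j].
  have -> : pair_comp 0 (la + mu) = pair_comp 0 la; last exact: Lie_comp.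
  apply: pair_comp_peqd; rewrite -[X in peqd _ _ X]addr0.
  by apply: peqdD => //; apply: Lie_no_const.
have [/Lie_comp-/(_ j.+1) Gla' /Lie_comp-/(_ j.+1) Gmu'] := (Gla, Gmu).
set la' := pair_comp _ la in Gla'; set mu' := pair_comp _ mu in Gmu'.
have [nu Gnu nuE] := unipotent_log (unipotent_mul (Lie_exp Gla') (Lie_exp
  Gmu')).
have la'0 := Lie_no_const Gla'; have mu'0 := Lie_no_const Gmu'.
have -> : pair_comp j.+1 (la + mu) = pair_comp j.+1 nu; last exact: Lie_comp.
rewrite pair_compD -(pair_comp_id _ la) -(pair_comp_id _ mu) -pair_compD.
apply/pair_comp_peqd/peqd_sym/pair_exp_peqd; first exact: Lie_no_const.
  by rewrite -(addr0 0); apply: peqdD.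
by rewrite nuE; apply: pair_exp_mul => //; apply: pair_comp_gr.
Qed.

(** The Lie algebra is the product of its homogeneous parts. An approximation
exp nu of exp ka in G, exact below degree d, is corrected in degree d by the
factor exp mu, where mu = (ka - nu)^(d): as the logarithm of an element of G,
nu is in the Lie algebra, and so are its homogeneous parts, hence mu. The
approximations converge to exp ka, and G is closed. *)
Lemma Lie_of_comps ka :
  peqd 1 ka 0 -> (forall j, Lie G (pair_comp j ka)) -> Lie G ka.
Proof.
have expG la : peqd 1 la 0 -> (forall j, Lie G (pair_comp j la)) ->
  G (pair_exp la).
  move=> la0 compG.
  have approx d : exists g, unipotent_part G g /\ peqd d.+1 g (pair_exp la).
    elim: d => [|d [g [Gg gE]]].
      exists one; split; first exact: unipotent_one.
      by apply/peqd_sym/pair_exp_one.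
    have [nu Gnu nuE] := unipotent_log Gg; have nu0 := Lie_no_const Gnu.
    have nula : peqd d.+1 nu la by rewrite -pair_exp_peqd ?nuE.
    set mu := pair_comp d.+1 (la - nu).
    have Gmu : Lie G mu.
      rewrite /mu pair_compD -scaleN1r pair_compZ -pair_comp_id -pair_compZ.
      rewrite -pair_compD; apply: Lie_compD; first exact: compG.
      by apply: LieZ.
    exists (pair_mul g (pair_exp mu)); split.
      by apply: unipotent_mul => //; apply: Lie_exp.
    rewrite -nuE.
    apply: peqd_trans (pair_exp_mul _ nu0 (pair_comp_gr _ _)) _ => //.
    have corr : peqd d.+2 (nu + mu) la.
      rewrite -[X in peqd _ _ X](subrKC nu); apply: peqdD => //.
      by apply/peqd_sym/peqd_comp/peqd_sub0/peqd_sym.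
    apply/pair_exp_peqd => //.
    by rewrite -(addr0 0); apply: peqdD => //; apply: Lie_no_const.
  have [g_ g_E] := choice approx; have [csG _] := lieG.
  apply: (csg_closed csG (g_ := g_)) => [d|].
    by have [/unipotent_partE[]] := g_E d.
  by split=> j; exists j => k le_k; apply/ptrunc_eqd; have [_ [g1 g2]] := g_E k;
     apply: eqd_le (leq_trans le_k (leqnSn k)) _.
move=> ka0 compG; split; first exact/pair_no_constE.
move=> t; rewrite -[pair_scale t ka]/(t *: ka); apply: expG.
  by case: ka0 => ? ?; rewrite -(scaler0 _ t); split; apply: eqdZ.
by move=> j; rewrite pair_compZ; apply: LieZ.
Qed.

Lemma LieD la mu : Lie G la -> Lie G mu -> Lie G (la + mu).
Proof.
move=> Gla Gmu; apply: Lie_of_comps; last by move=> j; apply: Lie_compD.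
by rewrite -(addr0 0); apply: peqdD; apply: Lie_no_const.
Qed.

Lemma Lie0 : Lie G 0.
Proof.
have [la Gla _] := unipotent_log unipotent_one.
by rewrite -(scale0r la); apply: LieZ.
Qed.

End LieAlgebra.

(** * Subspaces and orthogonality in finite dimension *)

Section Subspaces.
Variables (F : fieldType) (V : vectType F).

(** Take a subspace of largest dimension among those contained in S. *)
Lemma vspace_of_linear (S : V -> Prop) :
  S 0 -> (forall a u v, S u -> S v -> S (a *: u + v)) ->
  exists U : {vspace V}, forall v, v \in U <-> S v.
Proof.
move=> S0 Slin.
pose dims k := `[< exists U : {vspace V}, (forall v, v \in U -> S v) /\
  \dim U = k >].
have dims_ex : exists k, dims k.
  exists 0%N; apply/asboolP; exists 0%VS; rewrite dimv0.
  by split=> // v; rewrite memv0 => /eqP->.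
have dims_ub k : dims k -> (k <= \dim {:V})%N.
  by move=> /asboolP [U [_ <-]]; apply/dimvS/subvf.
have [k /asboolP [U [US dimU]] kmax] := ex_maxnP dims_ex dims_ub.
exists U => v; split; first exact: US.
move=> Sv; have /kmax : dims (\dim (<[v]> + U)).
  apply/asboolP; exists (<[v]> + U)%VS; split=> // w /memv_addP [w1].
  by move=> /vlineP [a ->] [w2 /US Sw2 ->]; apply: Slin.
move=> le_k; have UvU : (U <= <[v]> + U)%VS by apply: addvSr.
have /eqP -> : U == (<[v]> + U)%VS by rewrite eqEdim UvU dimU.
by apply: subvP (memv_line v); apply: addvSl.
Qed.

Lemma decreasing_vspaces_stabilize (U : nat -> {vspace V}) :
  (forall j, (U j.+1 <= U j)%VS) -> exists J, forall j, (J <= j)%N -> U j = U J.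
Proof.
move=> Udec.
have Ule i j : (i <= j)%N -> (U j <= U i)%VS.
  move=> /subnK <-; elim: (j - i)%N => [|k IHk]; first exact: subvv.
  by rewrite addSn; apply: subv_trans IHk.
pose dims k := `[< exists j, \dim (U j) = k >].
have dims_ex : exists k, dims k by exists (\dim (U 0)); apply/asboolP; exists 0.
have [k /asboolP [J dimJ] kmin] := ex_minnP dims_ex.
exists J => j le_J; apply/eqP; rewrite eqEdim Ule //= dimJ.
by apply: kmin; apply/asboolP; exists j.
Qed.

(* The properties of a Hermitian inner product that do not mention conjugation. *)
Section Form.
Variable form : V -> V -> F.
Hypothesis form_lin : forall a u v w, form (a *: u + v) w = a * form u w + form
  v w.
Hypothesis form_refl : forall u v, form u v = 0 -> form v u = 0.
Hypothesis form_def : forall u, form u u = 0 -> u = 0.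

Lemma form0l w : form 0 w = 0.
Proof.
by have := form_lin (-1) 0 0 w; rewrite scaler0 addr0 mulN1r addNr.
Qed.

Lemma formDl u v w : form (u + v) w = form u w + form v w.
Proof. by rewrite -[u]scale1r form_lin mul1r scale1r. Qed.

Lemma formZl a u w : form (a *: u) w = a * form u w.
Proof. by rewrite -[a *: u]addr0 form_lin form0l addr0. Qed.

Lemma formBl u v w : form (u - v) w = form u w - form v w.
Proof. by rewrite formDl -[- v]scaleN1r formZl mulN1r. Qed.

Lemma form_orthD u v w : form u v = 0 -> form u w = 0 -> form u (v + w) = 0.
Proof.
by move=> /form_refl uv /form_refl uw; apply: form_refl;
  rewrite formDl uv uw addr0.
Qed.

Lemma form_orthZ a u v : form u v = 0 -> form u (a *: v) = 0.
Proof. by move=> /form_refl uv; apply: form_refl; rewrite formZl uv mulr0. Qed.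

(** The Gram-Schmidt process along a basis of U. *)
Lemma orthogonal_projection (U : {vspace V}) x :
  exists2 u, u \in U & forall w, w \in U -> form (x - u) w = 0.
Proof.
rewrite -(span_basis (vbasisP U)).
elim: (tval (vbasis U)) x => [|v s IHs] x.
  exists 0; first exact: mem0v.
  by move=> w; rewrite span_nil memv0 => /eqP->; apply/form_refl/form0l.
have [u1 u1s orth1] := IHs v; have [u2 u2s orth2] := IHs x.
set v' := v - u1 in orth1; pose c := form (x - u2) v' / form v' v'.
(* When v' = 0, the coefficient c is 0 by the convention on division by 0. *)
have span_s w : w \in <<s>>%VS -> w \in <<v :: s>>%VS.
  by rewrite span_cons; apply/subvP/addvSr.
have span_v : v \in <<v :: s>>%VS by rewrite memv_span ?mem_head.
exists (u2 + c *: v').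
  by rewrite memvD ?memvZ ?memvB // span_s.
have orthE w : form (x - (u2 + c *: v')) w = form (x - u2) w - c * form v' w.
  by rewrite opprD addrA [LHS]formBl formZl.
have orth_v' : form (x - (u2 + c *: v')) v' = 0.
  rewrite orthE /c; have [v'0|nz] := eqVneq (form v' v') 0.
    rewrite v'0 mulr0 subr0 (form_def v'0); exact/form_refl/form0l.
  by rewrite divfK ?subrr.
have orth_s w : w \in <<s>>%VS -> form (x - (u2 + c *: v')) w = 0.
  by move=> ws; rewrite orthE orth1 // orth2 // mulr0 subrr.
move=> w; rewrite span_cons => /memv_addP [w1 /vlineP [a ->] [w2 w2s ->]].
apply: form_orthD; last exact: orth_s.
by apply: form_orthZ; rewrite -[v](subrK u1); apply: form_orthD => //;
  apply: orth_s.
Qed.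

Lemma orthogonal_complement (U : {vspace V}) :
  exists U' : {vspace V}, forall v,
    v \in U' <-> forall w, w \in U -> form v w = 0.
Proof.
apply: vspace_of_linear => [w _|a u v uU vU w wU]; first exact: form0l.
by rewrite form_lin uU // vU // mulr0 addr0.
Qed.

Lemma double_orthogonal (U : {vspace V}) w :
  (forall v, (forall u, u \in U -> form v u = 0) -> form w v = 0) -> w \in U.
Proof.
have [u uU orth] := orthogonal_projection U w.
move=> w_orth; suff /form_def/eqP : form (w - u) (w - u) = 0.
  by rewrite subr_eq0 => /eqP->.
by rewrite formBl w_orth // (form_refl (orth _ uU)) subrr.
Qed.

(** The orthogonal complement of an intersection is the sum of the orthogonal
complements: the part of b orthogonal to that sum lies in both biorthogonals,
hence in the intersection, to which b is orthogonal. *)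
Lemma orthogonal_of_capv (W Y : {vspace V}) b :
  (forall v, v \in W -> v \in Y -> form b v = 0) ->
  exists u, (forall y, y \in Y -> form u y = 0) /\
            (forall w, w \in W -> form (b - u) w = 0).
Proof.
move=> b_orth; have [W' W'P] := orthogonal_complement W.
have [Y' Y'P] := orthogonal_complement Y.
have [s sWY orth] := orthogonal_projection (W' + Y') b.
have [w' w'W [u uY sE]] := memv_addP sWY.
have rW : b - s \in W.
  apply: double_orthogonal => v /W'P vW'; apply: orth.
  by apply: subvP vW'; apply: addvSl.
have rY : b - s \in Y.
  apply: double_orthogonal => v /Y'P vY'; apply: orth.
  by apply: subvP vY'; apply: addvSr.
have /form_def/eqP : form (b - s) (b - s) = 0.
  by rewrite formBl b_orth // (form_refl (orth _ sWY)) subrr.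
rewrite subr_eq0 => /eqP bs; exists u; split; first exact/Y'P.
by rewrite bs sE addrK; apply/W'P.
Qed.

End Form.
End Subspaces.

(** * The inner product *)

Section Conjugate.
Variables (R : realType) (K : fieldType) (iota : {rmorphism K -> R[i]}).
Variable cj : K -> K.
Hypothesis cjE : forall a : K, iota (cj a) = conjc (iota a).

Lemma cjD : {morph cj : a b / a + b}.
Proof. by move=> a b; apply: (fmorph_inj iota); rewrite !(cjE, rmorphD). Qed.

Lemma cjM : {morph cj : a b / a * b}.
Proof. by move=> a b; apply: (fmorph_inj iota); rewrite !(cjE, rmorphM). Qed.

Lemma cj0 : cj 0 = 0.
Proof. by apply: (fmorph_inj iota); rewrite !(cjE, rmorph0). Qed.

Lemma cjN : {morph cj : a / - a}.
Proof. by move=> a; apply: (fmorph_inj iota); rewrite !(cjE, rmorphN). Qed.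

Lemma cj_nat k : cj k%:R = k%:R.
Proof. by apply: (fmorph_inj iota); rewrite !(cjE, rmorph_nat). Qed.

Lemma cjK : involutive cj.
Proof. by move=> a; apply: (fmorph_inj iota); rewrite !cjE conjcK. Qed.

Lemma iota_norm_ge0 a : 0 <= iota (cj a * a).
Proof.
by rewrite rmorphM cjE -[conjc _]/((iota a)^* )%R mulrC
  Num.Theory.mul_conjC_ge0.
Qed.

Lemma iota_norm_eq0 a : iota (cj a * a) = 0 -> a = 0.
Proof.
move/eqP; rewrite rmorphM cjE -[conjc _]/((iota a)^* )%R mulrC.
by rewrite Num.Theory.mul_conjC_eq0 fmorph_eq0 => /eqP.
Qed.

Lemma trace_adjmx m n (A B : 'M[K]_(m, n)) :
  \tr (adjmx cj B *m A) = \sum_k \sum_i cj (B i k) * A i k.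
Proof.
by apply: eq_bigr => k _; rewrite mxE; apply: eq_bigr => i _; rewrite !mxE.
Qed.

Lemma trace_adjmx_conj m n (A B : 'M[K]_(m, n)) :
  \tr (adjmx cj A *m B) = cj (\tr (adjmx cj B *m A)).
Proof.
rewrite !trace_adjmx (big_morph _ cjD cj0); apply: eq_bigr => k _.
rewrite (big_morph _ cjD cj0); apply: eq_bigr => i _.
by rewrite cjM cjK mulrC.
Qed.

Lemma adjmxM m n k (A : 'M[K]_(m, n)) (B : 'M[K]_(n, k)) :
  adjmx cj (A *m B) = adjmx cj B *m adjmx cj A.
Proof.
apply/matrixP => a b; rewrite !mxE (big_morph _ cjD cj0).
by apply: eq_bigr => i _; rewrite !mxE cjM mulrC.
Qed.

Lemma adjmx_sum m n I r (P : pred I) (F : I -> 'M[K]_(m, n)) :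
  adjmx cj (\sum_(i <- r | P i) F i) = \sum_(i <- r | P i) adjmx cj (F i).
Proof.
apply: (big_morph (@adjmx K cj m n)) => [A B|]; apply/matrixP => a b;
  by rewrite !mxE (cjD, cj0).
Qed.

Lemma adjmx0 m n : adjmx cj (0 : 'M[K]_(m, n)) = 0.
Proof. by apply/matrixP => a b; rewrite !mxE cj0. Qed.

Section Form.
Variables (p N : nat).

(** Truncated series: the finite-dimensional spaces in which orthogonality is
studied. *)
Definition tspace m n := {ffun 'X_{1..p < N} -> 'M[K]_(m, n)}.

Definition vform m n (u v : tspace m n) : K :=
  \sum_I (mfact (bmnm I))%:R * \tr (adjmx cj (v I) *m u I).

Lemma vform_lin m n a (u v w : tspace m n) :
  vform (a *: u + v) w = a * vform u w + vform v w.
Proof.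
rewrite /vform big_distrr -big_split /=; apply: eq_bigr => I _.
rewrite !ffunE mulmxDr mxtraceD -scalemxAr mxtraceZ mulrDr.
by rewrite mulrCA.
Qed.

Lemma vformNl m n (u w : tspace m n) : vform (- u) w = - vform u w.
Proof.
rewrite /vform -sumrN; apply: eq_bigr => I _.
by rewrite ffunE mulmxN raddfN mulrN.
Qed.

Lemma vformBl m n (u v w : tspace m n) : vform (u - v) w = vform u w - vform v
  w.
Proof. by rewrite addrC -scaleN1r vform_lin mulN1r addrC. Qed.

Lemma vform_conj m n (u v : tspace m n) : vform v u = cj (vform u v).
Proof.
rewrite /vform (big_morph _ cjD cj0); apply: eq_bigr => I _.
by rewrite cjM cj_nat trace_adjmx_conj.
Qed.

Lemma vform_refl m n (u v : tspace m n) : vform u v = 0 -> vform v u = 0.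
Proof. by move=> uv; rewrite vform_conj uv cj0. Qed.

Lemma iota_trace_ge0 m n (A : 'M[K]_(m, n)) : 0 <= iota (\tr (adjmx cj A *m A)).
Proof.
rewrite trace_adjmx raddf_sum; apply: Num.Theory.sumr_ge0 => k _.
by rewrite raddf_sum; apply: Num.Theory.sumr_ge0 => i _; apply: iota_norm_ge0.
Qed.

Lemma iota_vform_term_ge0 m n (u : tspace m n) I :
  0 <= iota ((mfact (bmnm I))%:R * \tr (adjmx cj (u I) *m u I)).
Proof.
by rewrite rmorphM rmorph_nat Num.Theory.mulr_ge0 ?Num.Theory.ler0n //
  iota_trace_ge0.
Qed.

Lemma iota_vform_ge0 m n (u : tspace m n) : 0 <= iota (vform u u).
Proof.
by rewrite raddf_sum; apply: Num.Theory.sumr_ge0 => I _;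
  apply: iota_vform_term_ge0.
Qed.

(** Through iota, the form is a sum of squared absolute values of complex
numbers with positive integer weights. *)
Lemma vform_def m n (u : tspace m n) : vform u u = 0 -> u = 0.
Proof.
move/(congr1 iota); rewrite raddf0 raddf_sum /= => sum0.
apply/ffunP => I; apply/matrixP => i k; rewrite ffunE mxE.
have := Num.Theory.psumr_eq0P (fun I _ => iota_vform_term_ge0 u I) sum0 (i :=
  I) isT.
move/eqP; rewrite rmorphM rmorph_nat mulf_eq0 Num.Theory.pnatr_eq0.
rewrite -[(mfact _ == 0)%N]negbK -lt0n prodn_gt0 /=; last first.
  by move=> j; apply: fact_gt0.
rewrite trace_adjmx raddf_sum /= => /eqP sumk0.
apply: iota_norm_eq0.
have inner0 k' : 0 <= iota (\sum_i' cj (u I i' k') * u I i' k').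
  by rewrite raddf_sum; apply: Num.Theory.sumr_ge0 => i' _;
    apply: iota_norm_ge0.
have := Num.Theory.psumr_eq0P (fun k' _ => inner0 k') sumk0 (i := k) isT.
rewrite raddf_sum /= => sumi0.
by apply: (Num.Theory.psumr_eq0P (fun i' _ => iota_norm_ge0 (u I i' k)) sumi0).
Qed.

Definition pvform m n (u v : (tspace m m * tspace n n)%type) : K :=
  vform u.1 v.1 + vform u.2 v.2.

Lemma pvform_lin m n a (u v w : (tspace m m * tspace n n)%type) :
  pvform (a *: u + v) w = a * pvform u w + pvform v w.
Proof. by rewrite /pvform !vform_lin mulrDr addrACA. Qed.

Lemma pvform_refl m n (u v : (tspace m m * tspace n n)%type) :
  pvform u v = 0 -> pvform v u = 0.
Proof.
have -> : pvform v u = cj (pvform u v) by rewrite /pvform cjD -!vform_conj.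
by move=> ->; rewrite cj0.
Qed.

Lemma pvform_def m n (u : (tspace m m * tspace n n)%type) :
  pvform u u = 0 -> u = 0.
Proof.
case: u => u1 u2; rewrite /pvform /= => /(congr1 iota)/eqP.
rewrite raddf0 raddfD /= Num.Theory.paddr_eq0 ?iota_vform_ge0 //.
by rewrite !fmorph_eq0 => /andP [/eqP/vform_def-> /eqP/vform_def->].
Qed.

Lemma pvformBl m n (u v w : (tspace m m * tspace n n)%type) :
  pvform (u - v) w = pvform u w - pvform v w.
Proof. by rewrite /pvform !vformBl addrACA -opprD. Qed.

Lemma pvform_projection m n (U : {vspace (tspace m m * tspace n n)}) x :
  exists2 u, u \in U & forall w, w \in U -> pvform (x - u) w = 0.
Proof.
apply: (@orthogonal_projection _ _ (@pvform m n)).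
- exact: pvform_lin.
- exact: pvform_refl.
- exact: pvform_def.
Qed.

Lemma vform_capv m n (W Y : {vspace (tspace m n)}) b :
  (forall v, v \in W -> v \in Y -> vform b v = 0) ->
  exists u, (forall y, y \in Y -> vform u y = 0) /\
            (forall w, w \in W -> vform (b - u) w = 0).
Proof.
apply: (@orthogonal_of_capv _ _ (@vform m n)).
- exact: vform_lin.
- exact: vform_refl.
- exact: vform_def.
Qed.

Lemma vform_projection m n (U : {vspace (tspace m n)}) x :
  exists2 u, u \in U & forall w, w \in U -> vform (x - u) w = 0.
Proof.
apply: (@orthogonal_projection _ _ (@vform m n)).
- exact: vform_lin.
- exact: vform_refl.
- exact: vform_def.
Qed.

Definition ftrunc m n (A : fmx K p m n) : tspace m n := [ffun I => A (bmnm I)].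

Lemma ftrunc_lin m n a (A B : fmx K p m n) :
  ftrunc (a *: A + B) = a *: ftrunc A + ftrunc B.
Proof. by apply/ffunP => I; rewrite !ffunE. Qed.

Lemma ftruncB m n (A B : fmx K p m n) : ftrunc (A - B) = ftrunc A - ftrunc B.
Proof. by apply/ffunP => I; rewrite !ffunE. Qed.

Lemma ftrunc0 m n : ftrunc (0 : fmx K p m n) = 0.
Proof. by apply/ffunP => I; rewrite !ffunE. Qed.

Lemma ftrunc_eqd m n (A B : fmx K p m n) : ftrunc A = ftrunc B <-> eqd N A B.
Proof.
split=> AB; last by apply/ffunP => I; rewrite !ffunE AB // bmdeg.
by move=> I lt_I; have /ffunP /(_ (BMultinom lt_I)) := AB; rewrite !ffunE.
Qed.

Lemma ftrunc_onto m n (u : tspace m n) : exists A : fmx K p m n, ftrunc A = u.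
Proof.
exists (fun I => if insub I is Some J then u J else 0).
by apply/ffunP => I; rewrite ffunE valK.
Qed.

Definition fform m n (A B : fmx K p m n) := vform (ftrunc A) (ftrunc B).

Lemma fformNl m n (A B : fmx K p m n) : fform (- A) B = - fform A B.
Proof. by rewrite /fform -[- A]sub0r ftruncB ftrunc0 sub0r vformNl. Qed.

Lemma fformBl m n (A A' B : fmx K p m n) :
  fform (A - A') B = fform A B - fform A' B.
Proof. by rewrite /fform ftruncB vformBl. Qed.

Lemma fformBr m n (A B B' : fmx K p m n) :
  fform A (B - B') = fform A B - fform A B'.
Proof.
by rewrite /fform ftruncB vform_conj vformBl cjD cjN -!vform_conj.
Qed.

Lemma fformDr m n (A B B' : fmx K p m n) :
  fform A (B + B') = fform A B + fform A B'.
Proof.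
have := fformBr A (B + B') B'; rewrite addrK => /eqP.
by rewrite eq_sym subr_eq => /eqP.
Qed.

Lemma fform0r m n (A : fmx K p m n) : fform A 0 = 0.
Proof. by rewrite -(subrr (0 : fmx K p m n)) fformBr subrr. Qed.

Lemma fformE m n (A B : fmx K p m n) :
  fform A B = \sum_(I : 'X_{1..p < N}) (mfact I)%:R * \tr (adjmx cj (B I) *m A
    I).
Proof. by apply: eq_bigr => I _; rewrite !ffunE. Qed.

End Form.
End Conjugate.

(** * The operator D_B is adjoint to the infinitesimal action *)

Section Adjunction.
Variables (R : realType) (K : fieldType) (iota : {rmorphism K -> R[i]}).
Variable cj : K -> K.
Hypothesis cjE : forall a : K, iota (cj a) = conjc (iota a).
Variable p : nat.

Definition vanish_from N m n (A : fmx K p m n) :=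
  forall I : 'X_{1..p}, (N <= mdeg I)%N -> A I = 0.

Lemma vanish_from_pmsize m n (P : pmx K p m n) N :
  (pmsize P <= N)%N -> vanish_from N (pcoef P).
Proof.
move=> le_N I le_I; apply/matrixP => a b; rewrite !mxE.
apply/memN_msupp_eq0/msize_mdeg_ge/(leq_trans _ (leq_trans le_N le_I)).
exact: leq_trans (leq_bigmax b) (leq_bigmax a).
Qed.

Lemma sum_vanish_from (V : nmodType) N M (F : 'X_{1..p} -> V) :
  (forall I : 'X_{1..p}, (N <= mdeg I)%N -> F I = 0) ->
  (forall I : 'X_{1..p}, (M <= mdeg I)%N -> F I = 0) ->
  \sum_(I : 'X_{1..p < N}) F I = \sum_(I : 'X_{1..p < M}) F I.
Proof.
move=> FN FM; wlog le_NM : N M FN FM / (N <= M)%N => [hwlog|].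
  by have [/hwlog|/ltnW/hwlog->] := leqP N M; first apply.
apply: (@eq_big_widen _ _ _ _ _ _ 'X_{1..p < N} 'X_{1..p < M} xpredT F).
  by move=> I /leq_trans; apply.
by move=> I; rewrite -leqNgt => /FN.
Qed.

Lemma fform_bound N M m n (A B : fmx K p m n) :
  vanish_from N A \/ vanish_from N B -> vanish_from M A \/ vanish_from M B ->
  fform cj N A B = fform cj M A B.
Proof.
move=> vN vM; rewrite !fformE.
pose F I := (mfact I)%:R * \tr (adjmx cj (B I) *m A I).
have FE k : vanish_from k A \/ vanish_from k B ->
    forall I : 'X_{1..p}, (k <= mdeg I)%N -> F I = 0.
  rewrite /F => -[] vk I /vk ->; rewrite ?mulmx0 ?mxtrace0 ?mulr0 //.
  by rewrite (adjmx0 cjE) mul0mx mxtrace0 mulr0.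
by apply: (@sum_vanish_from _ N M F); apply: FE.
Qed.

(** The bound on degrees in the inner product is immaterial as long as it
covers one of the two arguments. *)
Lemma pinnerE N m n (P Q : pmx K p m n) :
  vanish_from N (pcoef P) \/ vanish_from N (pcoef Q) ->
  pinner cj P Q = fform cj N (pcoef P) (pcoef Q).
Proof.
move=> vN; have -> : pinner cj P Q =
  fform cj (maxn (pmsize P) (pmsize Q)) (pcoef P) (pcoef Q) by rewrite fformE.
by apply: fform_bound vN; left; apply: vanish_from_pmsize; rewrite leq_maxl.
Qed.

(** The range of the two exponents can be made independent of I, so that sums
over I can be exchanged with it. *)
Lemma fmul_wide N m n k (A : fmx K p m n) (B : fmx K p n k) I : (mdeg I < N)%N
  ->
  fmul A B I =
  \sum_(J : 'X_{1..p < N, N} | I == (J.1 + J.2)%MM) A J.1 *m B J.2.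
Proof.
move=> lt_I; rewrite (eqd_fmul (@eqd_ptrunc _ _ _ _ N A) (@eqd_ptrunc _ _ _ _ N
  B)) //.
rewrite -pcoef_mul; apply/matrixP => a b; rewrite !mxE raddf_sum /= summxE.
under eq_bigr => c _ do rewrite (mcoeff_poly_mul _ _ lt_I).
rewrite exchange_big /=; apply: eq_bigr => J _; rewrite mxE.
apply: eq_bigr => c _; congr (_ * _).
  by have := pcoef_ptrunc N A J.1; rewrite bmdeg => <-; rewrite !mxE.
by have := pcoef_ptrunc N B J.2; rewrite bmdeg => <-; rewrite !mxE.
Qed.

Lemma mcoeff_fdiffop m n k (C : fmx K p m n) (P : pmx K p n k) J :
  pcoef (fdiffop C P) J = \sum_(I : 'X_{1..p < pmsize P})
    (\prod_(i < p) ((I + J)%MM i) ^_ (I i))%:R *: (C I *m pcoef P (I + J)%MM).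
Proof.
apply/matrixP => a b; rewrite mxE summxE summxE raddf_sum /=.
apply: eq_bigr => I _; rewrite !mxE raddf_sum /= mulr_sumr.
apply: eq_bigr => c _; rewrite !mxE mcoeffCM mcoeff_mderivm.
by rewrite [RHS]mulrCA mulr_natl.
Qed.

Lemma mfactD I J :
  (mfact J * \prod_(i < p) ((I + J)%MM i) ^_ (I i) = mfact (I + J)%MM)%N.
Proof.
rewrite /mfact -big_split /=; apply: eq_bigr => i _.
by have := ffact_fact (leq_addr (J i) (I i)); rewrite addKn mnmDE mulnC.
Qed.

(** Multiplication by x^I is adjoint to the derivation of multi-index I for the
inner product weighted by factorials. *)
Lemma pinner_fdiffop m n k (B : fmx K p m n) (P : pmx K p m k) (Q : pmx K p n
  k) :
  pinner cj (fdiffop (fadj cj B) P) Q =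
  fform cj (pmsize P) (pcoef P) (fmul B (pcoef Q)).
Proof.
set N := pmsize P; have P0 := @vanish_from_pmsize _ _ P N (leqnn _).
rewrite (@pinnerE N); last first.
  left=> J le_J; rewrite mcoeff_fdiffop big1 // => I _.
  by rewrite P0 ?mulmx0 ?scaler0 // mdegD (leq_trans le_J) // leq_addl.
pose T (I J : 'X_{1..p}) := (mfact (I + J)%MM)%:R *
  \tr (adjmx cj (pcoef Q J) *m (adjmx cj (B I) *m pcoef P (I + J)%MM)).
transitivity (\sum_(I : 'X_{1..p < N}) \sum_(J : 'X_{1..p < N}) T I J).
  rewrite fformE exchange_big /=; apply: eq_bigr => J _.
  rewrite mcoeff_fdiffop mulmx_sumr raddf_sum /= mulr_sumr.
  apply: eq_bigr => I _; rewrite -scalemxAr mxtraceZ mulrA -natrM mfactD.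
  by [].
rewrite pair_bigA fformE /=.
under [RHS]eq_bigr => H _ do rewrite (fmul_wide _ _ (bmdeg H)) (adjmx_sum cjE)
  mulmx_suml raddf_sum /= mulr_sumr.
rewrite (exchange_big_dep xpredT) //=; apply: eq_bigr => -[I J] _ /=.
have [lt_IJ|le_IJ] := ltnP (mdeg (I + J)) N.
  rewrite (big_pred1 (BMultinom lt_IJ)) /=; last by move=> H; rewrite /= bmeqP.
  by rewrite /T (adjmxM cjE) mulmxA.
rewrite /T P0 // !mulmx0 mxtrace0 mulr0 big1 // => H /eqP defH.
by have := bmdeg H; rewrite defH ltnNge le_IJ.
Qed.

Definition ftr m n (A : fmx K p m n) : fmx K p n m := fun I => (A I)^T.

Lemma ftr_mul m n k (A : fmx K p m n) (B : fmx K p n k) :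
  ftr (fmul A B) = fmul (ftr B) (ftr A).
Proof.
have ftr_trunc l l' (X : fmx K p l l') d : eqd d (ftr X) (pcoef (ptrunc d X)^T).
  by move=> I lt_I; rewrite /ftr (@eqd_ptrunc _ _ _ _ d X I lt_I) /pcoef
    map_trmx.
apply: eqdP => d; apply: eqd_trans (eqd_sym (eqd_fmul (ftr_trunc _ _ _ _)
  (ftr_trunc _ _ _ _))).
rewrite -pcoef_mul -trmx_mul /ftr => I lt_I.
rewrite (eqd_fmul (@eqd_ptrunc _ _ _ _ d A) (@eqd_ptrunc _ _ _ _ d B)) //.
by rewrite -pcoef_mul /pcoef map_trmx.
Qed.

Lemma fform_tr N m n (A B : fmx K p m n) :
  fform cj N (ftr A) (ftr B) = fform cj N A B.
Proof.
rewrite !fformE; apply: eq_bigr => I _; rewrite !trace_adjmx exchange_big /=.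
by congr (_ * _); apply: eq_bigr => i _; apply: eq_bigr => k _; rewrite !mxE.
Qed.

Lemma pcoef_tr m n (P : pmx K p m n) : pcoef P^T = ftr (pcoef P).
Proof. by apply/funext => I; rewrite /pcoef /ftr map_trmx. Qed.

Lemma pinner_tr m n (P Q : pmx K p m n) : pinner cj P^T Q^T = pinner cj P Q.
Proof.
pose N := maxn (pmsize P) (pmsize P^T).
rewrite !(@pinnerE N); first by rewrite !pcoef_tr fform_tr.
  by left; apply: vanish_from_pmsize; rewrite leq_maxl.
by left; apply: vanish_from_pmsize; rewrite leq_maxr.
Qed.

End Adjunction.

Section Bracket.
Variables (K : fieldType) (m n p : nat).
Implicit Types (la mu : fpair K m n p) (A B : fmx K p m n).

(** For la in the Lie algebra this is the tangent vector at B of the curve exp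
(t la).B; for la in the group, it vanishes exactly when la fixes B. *)
Definition bracket la B : fmx K p m n := fmul la.1 B - fmul B la.2.

Lemma bracketDl la mu B : bracket (la + mu) B = bracket la B + bracket mu B.
Proof. by rewrite /bracket fmulDl fmulDr opprD addrACA. Qed.

Lemma bracket0l B : bracket 0 B = 0.
Proof. by rewrite /bracket f0mul fmul0 subrr. Qed.

Lemma bracketZl a la B : bracket (a *: la) B = a *: bracket la B.
Proof. by rewrite /bracket fmulZl fmulZr scalerBr. Qed.

Lemma bracketBr la A B : bracket la (A - B) = bracket la A - bracket la B.
Proof. by rewrite /bracket fmulBl fmulBr !opprD !opprK addrACA. Qed.

Lemma eqd_bracketl d la mu B : peqd d la mu ->
  eqd d (bracket la B) (bracket mu B).
Proof. by case=> ? ?; apply: eqdB; apply: eqd_fmul. Qed.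

(** As la has no constant term, its action raises degrees: tangent vectors at A
are determined in degree d by A below degree d. *)
Lemma eqd_bracketr d la A B :
  peqd 1 la 0 -> eqd d A B -> eqd d.+1 (bracket la A) (bracket la B).
Proof.
move=> [la1 la2] /eqd_sub0 AB; apply/eqd_sub0; rewrite -bracketBr -(subr0 0).
apply: eqdB; first by rewrite -add1n; apply: eqd_fmul_gr.
by rewrite -addn1; apply: eqd_fmul_gr.
Qed.

End Bracket.

Section PairAdjunction.
Variables (R : realType) (K : fieldType) (iota : {rmorphism K -> R[i]}).
Variable cj : K -> K.
Hypothesis cjE : forall a : K, iota (cj a) = conjc (iota a).
Variables m n p : nat.

Lemma pcoefN k l (P : pmx K p k l) : pcoef (- P) = - pcoef P.
Proof. by apply/funext => I; apply/matrixP => a b; rewrite !mxE mcoeffN. Qed.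

Lemma pinnerN k l (P Q : pmx K p k l) : pinner cj (- P) Q = - pinner cj P Q.
Proof.
have vP := @vanish_from_pmsize _ _ _ _ P _ (leqnn _).
rewrite !(pinnerE cjE (N := pmsize P)); try by left.
  by rewrite pcoefN fformNl.
by left => I le_I; rewrite pcoefN [LHS]/GRing.opp /= vP ?oppr0.
Qed.

Lemma pair_inner_Dop N (B : fmx K p m n) (P : pmx K p m n) (ka : ppair K m n p)
  :
  vanish_from N (pcoef P) ->
  pair_inner cj (Dop cj B P) ka = fform cj N (pcoef P) (bracket (pair_coef ka)
    B).
Proof.
move=> vP; have vsz k l (Q : pmx K p k l) := @vanish_from_pmsize _ _ _ _ Q _
  (leqnn _).
rewrite /bracket (fformBr cjE); congr (_ + _) => /=.
  rewrite -[ka.1 in LHS]trmxK (pinner_tr cjE).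
  have -> : fadjT cj B = fadj cj (ftr B).
    by apply/funext => I; rewrite /fadjT /fadj /adjmx map_trmx.
  rewrite (pinner_fdiffop cjE) !pcoef_tr -ftr_mul fform_tr.
  apply: (fform_bound cjE); left => //.
  by move=> I /vsz/(congr1 trmx); rewrite pcoef_tr /ftr trmxK trmx0.
rewrite pinnerN (pinner_fdiffop cjE); congr (- _).
by apply: (fform_bound cjE); left.
Qed.

End PairAdjunction.

(** * The normal form equations *)

Section NormalForm.
Variables (R : realType) (K : fieldType) (iota : {rmorphism K -> R[i]}).
Variable cj : K -> K.
Hypothesis cjE : forall a : K, iota (cj a) = conjc (iota a).
Variables (m n p : nat) (G : set (fpair K m n p)).
Hypotheses (lieG : formal_lie_group G) (homG : homogeneous_Lie G).
Implicit Types (nu mu ka : ppair K m n p) (la : fpair K m n p).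

Definition pair_trunc N la : (tspace K p N m m * tspace K p N n n)%type :=
  (ftrunc N la.1, ftrunc N la.2).

Lemma pair_truncB N la la' : pair_trunc N (la - la') = pair_trunc N la -
  pair_trunc N la'.
Proof. by rewrite /pair_trunc !ftruncB. Qed.

Lemma pair_trunc_lin N a la la' : pair_trunc N (a *: la + la') = a *:
  pair_trunc N la + pair_trunc N la'.
Proof. by rewrite /pair_trunc !ftrunc_lin. Qed.

Lemma pair_trunc_peqd N la la' : pair_trunc N la = pair_trunc N la' <->
  peqd N la la'.
Proof. by split=> [[/ftrunc_eqd ? /ftrunc_eqd ?]|[/ftrunc_eqd e1 /ftrunc_eqd
  e2]]; [split|rewrite /pair_trunc e1 e2]. Qed.

Lemma pair_coef_inj : injective (@pair_coef K m n p).
Proof. by move=> [? ?] [? ?] [/pcoef_inj-> /pcoef_inj->]. Qed.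

Lemma pcoefB k l (P Q : pmx K p k l) : pcoef (P - Q) = pcoef P - pcoef Q.
Proof. by apply/funext => I; apply/matrixP => a b; rewrite !mxE mcoeffB. Qed.

Lemma pair_coefB nu mu : pair_coef (nu - mu) = pair_coef nu - pair_coef mu.
Proof. by rewrite /pair_coef /= !pcoefB. Qed.

Lemma pair_coef_add nu mu : pair_coef (nu + mu) = pair_coef nu + pair_coef mu.
Proof.
congr pair; apply/funext => I; apply/matrixP => a b;
  by rewrite !mxE mcoeffD.
Qed.

Lemma pair_coef0 : pair_coef (0 : ppair K m n p) = 0.
Proof. by rewrite -(subrr 0) pair_coefB subrr. Qed.

Lemma pair_comp0 j : pair_comp j (0 : fpair K m n p) = 0.
Proof. by rewrite -(scale0r (0 : fpair K m n p)) pair_compZ !scale0r. Qed.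

Lemma pair_compB j la la' : pair_comp j (la - la') = pair_comp j la - pair_comp
  j la'.
Proof. by rewrite -scaleN1r pair_compD pair_compZ scaleN1r. Qed.

Lemma Lie_homogB j nu mu :
  Lie_homog G j nu -> Lie_homog G j mu -> Lie_homog G j (nu - mu).
Proof.
move=> [la Gla <-] [la' Gla' <-]; exists (la - la').
  by rewrite -scaleN1r; apply: LieD => //; apply: LieZ.
by apply: pair_coef_inj; rewrite pair_coefB; apply: pair_compB.
Qed.

Lemma Lie_homog0 j : Lie_homog G j 0.
Proof.
exists 0; first exact: Lie0.
by apply: pair_coef_inj; rewrite pair_coef0; apply: pair_comp0.
Qed.

Lemma pair_inner_homog j nu la :
  pair_inner cj nu (pair_homog j la) =
  pvform cj (pair_trunc j.+1 (pair_coef nu)) (pair_trunc j.+1 (pair_comp j la)).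
Proof.
have vh k l (A : fmx K p k l) : vanish_from j.+1 (pcoef (phomog j A)).
  by move=> I lt_I; rewrite pcoef_phomog gtn_eqF.
by rewrite /pair_inner !(pinnerE cjE (N := j.+1)) //; right; apply: vh.
Qed.

(** The choice in the definition of the projector succeeds, because the
homogeneous part of degree j of the Lie algebra is a subspace of a space of
finite dimension. *)
Lemma delta_homog_spec j nu :
  Lie_homog G j (delta_homog cj G j nu) /\
  forall ka, Lie_homog G j ka -> pair_inner cj (nu - delta_homog cj G j nu) ka
    = 0.
Proof.
suff [mu mu_spec] : exists mu, Lie_homog G j mu /\
    forall ka, Lie_homog G j ka -> pair_inner cj (nu - mu) ka = 0.
  by rewrite /delta_homog; case: xgetP => [mu' _ //|no_mu]; case: (no_mu mu).
pose S v := exists2 la, Lie G la & v = pair_trunc j.+1 (pair_comp j la).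
have [||U US] := @vspace_of_linear _ _ S.
- exists 0; first exact: Lie0.
  by rewrite pair_comp0 /pair_trunc !ftrunc0.
- move=> a u v [la Gla ->] [la' Gla' ->]; exists (a *: la + la').
    by apply: LieD => //; apply: LieZ.
  by rewrite pair_compD pair_compZ pair_trunc_lin.
have [u /US [la Gla uE] orth] := pvform_projection cjE U (pair_trunc j.+1
  (pair_coef nu)).
exists (pair_homog j la); split; first by exists la.
move=> _ [la' Gla' <-]; rewrite pair_inner_homog pair_coefB pair_truncB.
by rewrite -[pair_coef (pair_homog _ _)]/(pair_comp _ _) -uE orth //; apply/US;
  exists la'.
Qed.

Lemma pair_innerB j nu mu la :
  pair_inner cj (nu - mu) (pair_homog j la) =
  pair_inner cj nu (pair_homog j la) - pair_inner cj mu (pair_homog j la).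
Proof.
rewrite !pair_inner_homog pair_coefB pair_truncB.
exact: pvformBl.
Qed.

Lemma delta_homog_unique j nu mu :
  Lie_homog G j mu ->
  (forall ka, Lie_homog G j ka -> pair_inner cj (nu - mu) ka = 0) ->
  delta_homog cj G j nu = mu.
Proof.
move=> Lmu orth; have [Ld orthd] := delta_homog_spec j nu.
move: (delta_homog cj G j nu) Ld orthd => d Ld orthd.
have [la Gla defla] := Lie_homogB Ld Lmu.
have Lla : Lie_homog G j (pair_homog j la) by exists la.
have : pair_inner cj (d - mu) (pair_homog j la) = 0.
  have /eqP := orth _ Lla; have /eqP := orthd _ Lla.
  by rewrite !pair_innerB !subr_eq0 => /eqP <- /eqP ->; rewrite subrr.
rewrite -defla pair_inner_homog => /(pvform_def cjE).
rewrite -[pair_coef _]/(pair_comp _ _) => ptr0.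
suff : pair_coef (d - mu) = pair_coef 0.
  by move/pair_coef_inj/eqP; rewrite subr_eq0 => /eqP.
rewrite -defla -[LHS]/(pair_comp j la) pair_coef0; apply: peqdP => k.
have : peqd j.+1 (pair_comp j la) 0.
  by apply/pair_trunc_peqd; rewrite ptr0 /pair_trunc !ftrunc0.
move=> [c1 c2]; split=> I _; rewrite (pair_comp1, pair_comp2); case: eqP =>
  // degI.
  by have := c1 I; rewrite pair_comp1 degI eqxx => ->.
by have := c2 I; rewrite pair_comp2 degI eqxx => ->.
Qed.

Lemma delta_homog_eq j nu mu :
  delta_homog cj G j nu = delta_homog cj G j mu <->
  forall ka, Lie_homog G j ka -> pair_inner cj nu ka = pair_inner cj mu ka.
Proof.
have [Lmu orthm] := delta_homog_spec j mu; have [_ orthn] :=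
  delta_homog_spec j nu.
split=> [eq_d ka Lka | eq_inner].
  move: orthm orthn; rewrite -eq_d; move: (delta_homog cj G j nu) =>
    d orthm orthn.
  have [la _ defka] := Lka; move: (orthn _ Lka) (orthm _ Lka).
  by rewrite -defka !pair_innerB => /subr0_eq -> /subr0_eq ->.
move: (delta_homog cj G j mu) Lmu orthm => d Ld orthd.
apply: delta_homog_unique; first exact: Ld.
move=> ka Lka; have [la _ defka] := Lka; have := orthd _ Lka.
by rewrite -defka !pair_innerB defka eq_inner.
Qed.

Lemma pair_inner_comp j nu ka : Lie_homog G j ka ->
  pair_inner cj (pair_homog j (pair_coef nu)) ka = pair_inner cj nu ka.
Proof.
move=> [la _ <-]; rewrite !pair_inner_homog -[pair_coef (pair_homog _
  _)]/(pair_comp _ _).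
congr (_ + _); apply: eq_bigr => I _; rewrite !ffunE ?pair_comp1 ?pair_comp2;
  by case: eqP; rewrite // (adjmx0 cjE) !mul0mx.
Qed.

Lemma delta_comp j nu :
  pair_comp j (pair_coef (delta cj G nu)) =
  pair_coef (delta_homog cj G j (pair_homog j (pair_coef nu))).
Proof.
pose D i := delta_homog cj G i (pair_homog i (pair_coef nu)).
have compD i : pair_comp j (pair_coef (D i)) = if i == j then pair_coef (D i)
  else 0.
  have [[la _ defD] _] := delta_homog_spec i (pair_homog i (pair_coef nu)).
  rewrite /D -defD -/(pair_comp i la); case: eqVneq => [->|ne_ij].
    exact: pair_comp_id.
  apply: pair_ext => I; rewrite !(pair_comp1, pair_comp2);
    by case: eqP => // ->; rewrite eq_sym (negbTE ne_ij).
rewrite /delta; set N := maxn _ _.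
transitivity (\sum_(i < N) pair_comp j (pair_coef (D i))).
  elim/big_rec2: _ => [|i x y _ <-].
    by rewrite pair_coef0 pair_comp0.
  by rewrite pair_coef_add pair_compD.
under eq_bigr => i _ do rewrite compD.
have [lt_jN|le_Nj] := ltnP j N.
  rewrite (bigD1 (Ordinal lt_jN)) //= eqxx big1 ?addr0 // => i.
  by rewrite -val_eqE /= => /negbTE->.
rewrite big1 => [|i _]; last by rewrite ltn_eqF // (leq_trans (ltn_ord i)).
apply/esym; rewrite -[RHS]pair_coef0; congr pair_coef.
have -> : pair_homog j (pair_coef nu) = 0.
  apply: pair_coef_inj; rewrite pair_coef0 -[LHS]/(pair_comp _ _).
  apply: pair_ext => I; rewrite (pair_comp1, pair_comp2); case: eqP => // degI;
    apply: (vanish_from_pmsize (N := N)); rewrite ?degI //;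
    by rewrite /N (leq_maxl, leq_maxr).
apply: delta_homog_unique; first exact: Lie_homog0.
by move=> _ [la Gla <-]; rewrite pair_innerB subrr.
Qed.

(** The summands of delta are homogeneous of distinct degrees, so that delta
can be compared one degree at a time. *)
Lemma delta_eq nu mu : delta cj G nu = delta cj G mu <->
  forall j ka, Lie_homog G j ka -> pair_inner cj nu ka = pair_inner cj mu ka.
Proof.
have eq_inner j : (forall ka, Lie_homog G j ka ->
  pair_inner cj nu ka = pair_inner cj mu ka) <->
    delta_homog cj G j (pair_homog j (pair_coef nu)) =
    delta_homog cj G j (pair_homog j (pair_coef mu)).
  rewrite delta_homog_eq; split=> eq_j ka Lka; have := eq_j ka Lka;
    by rewrite !(pair_inner_comp _ Lka).
split=> [eq_d j|eq_d].
  by apply/eq_inner/pair_coef_inj; rewrite -!delta_comp eq_d.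
have {}eq_d j : pair_comp j (pair_coef (delta cj G nu)) =
    pair_comp j (pair_coef (delta cj G mu)).
  by rewrite !delta_comp; congr pair_coef; apply/eq_inner/eq_d.
apply: pair_coef_inj; apply: pair_ext => I.
  by have := congr1 (fun x => x.1 I) (eq_d (mdeg I)); rewrite !pair_comp1 eqxx.
by have := congr1 (fun x => x.2 I) (eq_d (mdeg I)); rewrite !pair_comp2 eqxx.
Qed.

Lemma fform_eqd N (A A' B B' : fmx K p m n) :
  eqd N A A' -> eqd N B B' -> fform cj N A B = fform cj N A' B'.
Proof. by move=> /ftrunc_eqd AA /ftrunc_eqd BB; rewrite /fform AA BB. Qed.

Lemma fform_top j (A A' Z : fmx K p m n) : eqd j Z 0 ->
  (forall I, mdeg I = j -> A I = A' I) -> fform cj j.+1 A Z = fform cj j.+1 A'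
    Z.
Proof.
move=> Z0 AA; rewrite !fformE; apply: eq_bigr => I _.
have := bmdeg I; rewrite ltnS leq_eqVlt => /orP [/eqP/AA->//|lt_I].
by rewrite (Z0 _ lt_I) (adjmx0 cjE) !mul0mx.
Qed.

Lemma peqd_sum_comp N la : peqd N (\sum_(i < N) pair_comp i la) la.
Proof.
have sumE I :
   (\sum_(i < N) pair_comp i la).1 I = (if (mdeg I < N)%N then la.1 I else 0) /\
   (\sum_(i < N) pair_comp i la).2 I = if (mdeg I < N)%N then la.2 I else 0.
  elim: N => [|N [IH1 IH2]]; first by rewrite big_ord0.
  rewrite big_ord_recr !pair_coefE IH1 IH2 pair_comp1 pair_comp2.
  rewrite [(mdeg I < N.+1)%N]ltnS [(mdeg I <= N)%N]leq_eqVlt.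
  by split; case: eqVneq => [->|_]; rewrite ?ltnn ?add0r ?addr0.
by split=> I lt_I; have [] := sumE I; rewrite lt_I.
Qed.

(** As the tangent vectors considered have no part of degree less than j, only
B^(j) matters in the product; and only the part of B of degree less than j
matters in the degree j part of those vectors. *)
Definition normal_at j (B : fmx K p m n) := forall la, Lie G la ->
  eqd j (bracket la B) 0 -> fform cj j.+1 B (bracket la B) = 0.

(** Modulo degree N an element of the Lie algebra is a finite sum of
homogeneous ones. *)
Lemma fform_bracket_homog N (T B : fmx K p m n) :
  (forall i ka, Lie_homog G i ka ->
     fform cj N T (bracket (pair_coef ka) B) = 0) <->
  (forall la, Lie G la -> fform cj N T (bracket la B) = 0).
Proof.
split=> orth; last first.
  by move=> i ka [la Gla <-]; apply: orth; apply: Lie_comp.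
move=> la Gla; have /eqd_bracketl-/(_ B)/eqd_sym := peqd_sum_comp N la.
move=> /(fform_eqd (@eqd_refl _ _ _ _ _ T)) ->.
elim/big_ind: _ => [|x y xT yT|i _].
- by rewrite bracket0l (fform0r cjE).
- by rewrite bracketDl (fformDr cjE) xT yT addr0.
by apply: (orth i); exists la.
Qed.

(** By adjointness, the equation for f says that B^(j) - f, with f of degree
less than j, is orthogonal to the space W of tangent vectors at B. Now the
matrices of degree less than j are the orthogonal complement of the space Y of
those homogeneous of degree j, so that a suitable f exists exactly when B^(j)
is in the sum of the orthogonal complements of W and Y, which is that of their
intersection. *)
Lemma normal_atP j (B : fmx K p m n) :
  (exists f, delta cj G (Dop cj B (phomog j B)) =
             delta cj G (Dop cj B (ptrunc j f))) <-> normal_at j B.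
Proof.
have vh : vanish_from j.+1 (pcoef (phomog j B)).
  by move=> I lt_I; rewrite pcoef_phomog gtn_eqF.
have vt (f : fmx K p m n) : vanish_from j.+1 (pcoef (ptrunc j f)).
  by move=> I lt_I; rewrite pcoef_ptrunc ltnNge ltnW.
have deltaE f : delta cj G (Dop cj B (phomog j B)) = delta cj G (Dop cj B
  (ptrunc j f))
   <-> forall la, Lie G la ->
     fform cj j.+1 (pcoef (phomog j B) - pcoef (ptrunc j f)) (bracket la B) = 0.
  rewrite delta_eq -fform_bracket_homog; split=> eq_in i ka Lka.
    by have := eq_in i ka Lka; rewrite (pair_inner_Dop cjE _ _ vh)
      (pair_inner_Dop cjE _ _ (vt f)) fformBl => ->; rewrite subrr.
  have /eqP := eq_in i ka Lka; rewrite fformBl subr_eq0 => /eqP.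
  by rewrite (pair_inner_Dop cjE _ _ vh) (pair_inner_Dop cjE _ _ (vt f)).
split=> [[f /deltaE orth] la Gla brB|normB].
  rewrite -[RHS](orth _ Gla); apply: fform_top => // I degI.
  by rewrite [RHS]/GRing.add /= [X in _ + X]/GRing.opp /= pcoef_phomog
    pcoef_ptrunc degI eqxx ltnn subr0.
pose SW v := exists2 la, Lie G la & v = ftrunc j.+1 (bracket la B).
pose SY (v : tspace K p j.+1 m n) := forall I, (mdeg (bmnm I) < j)%N -> v I = 0.
have [||W WP] := @vspace_of_linear _ _ SW.
- exists 0; first exact: Lie0.
  by rewrite bracket0l ftrunc0.
- move=> a u v [la Gla ->] [la' Gla' ->]; exists (a *: la + la').
    by apply: LieD => //; apply: LieZ.
  by rewrite bracketDl bracketZl ftrunc_lin.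
have [||Y YP] := @vspace_of_linear _ _ SY.
- by move=> I _; rewrite ffunE.
- by move=> a u v u0 v0 I lt_I; rewrite !ffunE u0 // v0 // scaler0 addr0.
have [|u [uY bW]] := vform_capv cjE (W := W) (Y := Y) (b := ftrunc j.+1 B).
  move=> _ /WP [la Gla ->] /YP brB; apply: normB => // I lt_I.
  have lt_I' := leq_trans lt_I (leqnSn j).
  by have := brB (BMultinom lt_I') lt_I; rewrite ffunE.
have [U UE] := ftrunc_onto u.
have U_top I : mdeg I = j -> U I = 0.
  pose y : tspace K p j.+1 m n := [ffun J => if mdeg (bmnm J) == j then u J
    else 0].
  have yY : y \in Y by apply/YP => J lt_J; rewrite ffunE ltn_eqF.
  have : vform cj y y = 0.
    rewrite -[RHS](uY y yY); apply: eq_bigr => J _; rewrite !ffunE.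
    by case: eqP => // _; rewrite (adjmx0 cjE) !mul0mx.
  move=> /(vform_def cjE) y0 degI; have lt_I : (mdeg I < j.+1)%N by rewrite
    degI.
  have := congr1 (fun v : tspace K p j.+1 m n => v (BMultinom lt_I)) y0.
  by rewrite !ffunE /= degI eqxx -UE ffunE.
(* U vanishes in degree j, and U - B is the lower part that turns B^(j) into
   B - U modulo degree j.+1. *)
exists (U - B); apply/deltaE => la Gla.
have /bW : ftrunc j.+1 (bracket la B) \in W by apply/WP; exists la.
rewrite -UE -ftruncB => <-; apply: fform_eqd => // I.
rewrite ltnS leq_eqVlt ![(_ - _) I]/GRing.add /= ![(- _) I]/GRing.opp /=.
rewrite pcoef_phomog pcoef_ptrunc => /orP [/eqP degI|lt_I].
  by rewrite degI eqxx ltnn U_top.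
by rewrite lt_I ltn_eqF // sub0r opprB.
Qed.

End NormalForm.

(** * Orbits are closed *)

Section Orbits.
Variables (K : fieldType) (m n p : nat) (G : set (fpair K m n p)).
Hypotheses (lieG : formal_lie_group G) (homG : homogeneous_Lie G).
Implicit Types (g h la : fpair K m n p) (A B C : fmx K p m n).
Local Notation one := (pair_one K m n p).

Lemma eqd_bracket_exp d la A : peqd 1 la 0 -> eqd d (bracket la A) 0 ->
  eqd d.+1 (bracket (pair_exp la) A) (bracket la A).
Proof. by move=> [la1 la2]; apply: fexp_intertwine. Qed.

(** A unipotent element and its logarithm fix the same truncations of A: where
one of the two brackets first fails to vanish, both have the same leading part.
*)
Lemma bracket_exp_eq0 d la A : peqd 1 la 0 ->
  eqd d (bracket (pair_exp la) A) 0 <-> eqd d (bracket la A) 0.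
Proof.
move=> la0; elim: d => [|d IHd]; first by split=> _; apply: eqd0.
split=> br0; have br0' := eqd_le (leqnSn d) br0.
  have br0l := proj1 IHd br0'.
  exact: eqd_trans (eqd_sym (eqd_bracket_exp la0 br0l)) br0.
exact: eqd_trans (eqd_bracket_exp la0 br0') br0.
Qed.

Lemma eqd_intertwine_inv d g h A B : pair_inverse g h ->
  eqd d (fmul g.1 A) (fmul B g.2) -> eqd d (fmul h.1 B) (fmul A h.2).
Proof.
move=> [[_ hg] [gh _]] gAB.
rewrite -[fmul h.1 B]fmul1 -[X in eqd _ _ X]f1mul -hg -gh !fmulA.
apply: eqd_fmul => //; rewrite -!fmulA; apply: eqd_fmul => //.
exact: eqd_sym.
Qed.

Lemma unipotent_equivP A B : unipotent_equiv G A B <->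
  exists2 g, unipotent_part G g & fmul g.1 A = fmul B g.2.
Proof.
split=> [[g [h [Gg [[_ [gh hg]] ->]]]]|[g Gg gAB]].
  by exists g => //; rewrite -fmulA hg fmul1.
have [h Gh gh] := unipotent_inv lieG Gg; exists g, h; split=> //; split=> //.
by rewrite gAB -fmulA; case: gh => _ [-> _]; rewrite fmul1.
Qed.

(** Assume that for each d some g' agreeing with g below degree i carries A to
B modulo degree d. The possible components of degree i of these g' form a coset
of the space of the degree i components of the logarithms, vanishing below
degree i, that fix A modulo degree d. These spaces decrease with d and have
finite dimension, hence they become constant from some J on, and so do the
cosets: a component of degree i that works for d = J works for every d. *)
Lemma orbit_closed_step A B i g :
  (forall d, exists g', [/\ unipotent_part G g', peqd i g' g &
     eqd d (fmul g'.1 A) (fmul B g'.2)]) ->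
  exists2 g1, peqd i g1 g & forall d, exists g', [/\ unipotent_part G g',
     peqd i.+1 g' g1 & eqd d (fmul g'.1 A) (fmul B g'.2)].
Proof.
move=> approx.
pose S d v := exists la, [/\ Lie G la, peqd i la 0, eqd d (bracket la A) 0 &
  v = (ftrunc i.+1 la.1, ftrunc i.+1 la.2)].
have SP d : exists U : {vspace (tspace K p i.+1 m m * tspace K p i.+1 n n)},
    forall v, v \in U <-> S d v.
  apply: vspace_of_linear => [|a u v [la [Gla la0 brla ->]] [mu [Gmu mu0 brmu
    ->]]].
    by exists 0; split; rewrite ?bracket0l ?ftrunc0 //; apply: Lie0.
  exists (a *: la + mu); split.
  - by apply: LieD => //; apply: LieZ.
  - rewrite -(addr0 0); apply: peqdD => //.
    by case: la0 => ? ?; rewrite -(scaler0 _ a); split; apply: eqdZ.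
  - rewrite bracketDl bracketZl -(addr0 0); apply: eqdD => //.
    by rewrite -(scaler0 _ a); apply: eqdZ.
  - by rewrite !ftrunc_lin.
have [U UP] := choice SP.
have [J stabJ] : exists J, forall d, (J <= d)%N -> U d = U J.
  apply: decreasing_vspaces_stabilize => d; apply/subvP =>
    v /UP [la [? ? ? ->]].
  by apply/UP; exists la; split=> //; apply: eqd_le (leqnSn d) _.
have [g1 [Gg1 g1g g1AB]] := approx J.
exists g1 => // d0; pose d := maxn J d0.
have [g2 [Gg2 g2g g2AB]] := approx d.
have [g1' Gg1' g1V] := unipotent_inv lieG Gg1.
(* h fixes A modulo degree J, and is replaced by h' fixing A modulo degree d. *)
pose h := pair_mul g1' g2.
have Gh : unipotent_part G h by apply: unipotent_mul.
have [la Gla laE] := unipotent_log lieG Gh; have la0 := Lie_no_const Gla.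
have la_i : peqd i la 0.
  rewrite -pair_exp_peqd // laE pair_exp0 -(pair_mulVr g1V).
  by apply: peqd_mul => //; apply: peqd_trans g2g (peqd_sym g1g).
have br_la : eqd J (bracket la A) 0.
  rewrite -bracket_exp_eq0 // laE; apply/eqd_sub0 => /=.
  rewrite -fmulA.
  have le_Jd : (J <= d)%N by apply: leq_maxl.
  apply: eqd_trans (eqd_fmul (@eqd_refl _ _ _ _ _ _) (eqd_le le_Jd g2AB)) _.
  rewrite !fmulA; apply: eqd_fmul => //.
  exact: eqd_intertwine_inv g1V g1AB.
have : S J (ftrunc i.+1 la.1, ftrunc i.+1 la.2) by exists la.
move=> /UP; rewrite -(stabJ d (leq_maxl _ _)) =>
  /UP [mu [Gmu mu_i br_mu [mu1 mu2]]].
have mu0 := Lie_no_const Gmu; pose h' := pair_exp mu.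
have Gh' : unipotent_part G h' by apply: Lie_exp.
have hh' : peqd i.+1 h h'.
  rewrite -laE pair_exp_peqd //; split; exact/ftrunc_eqd.
have [k Gk h'k] := unipotent_inv lieG Gh'.
exists (pair_mul g2 k); split; first exact: unipotent_mul.
  have -> : g2 = pair_mul g1 h by rewrite /h pair_mulA (pair_mulV g1V)
    pair_1mul.
  rewrite -[X in peqd _ _ X]pair_mul1 -(pair_mulV h'k) -pair_mulA.
  by do 2 apply: peqd_mul => //.
apply: (@eqd_le _ _ _ _ d); first exact: leq_maxr.
have br_h' : eqd d (fmul h'.1 A) (fmul A h'.2).
  by apply/eqd_sub0; rewrite -[_ - _]/(bracket h' A) bracket_exp_eq0.
have kA : eqd d (fmul k.1 A) (fmul A k.2).
  exact: eqd_intertwine_inv h'k br_h'.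
rewrite /= -fmulA.
apply: eqd_trans (eqd_fmul (@eqd_refl _ _ _ _ _ _) kA) _.
by rewrite !fmulA; apply: eqd_fmul.
Qed.

Lemma unipotent_limit (g_ : nat -> fpair K m n p) g :
  (forall d, unipotent_part G (g_ d)) -> (forall d, peqd d g (g_ d)) ->
  unipotent_part G g.
Proof.
move=> Gg_ gE; rewrite unipotent_partE; have [csG _] := lieG; split.
  apply: (csg_closed csG (g_ := g_)) => [d|]; first by case: (Gg_ d).
  by split=> j; exists j => d le_jd; apply/ptrunc_eqd/eqd_sym;
     have [? ?] := gE d; apply: eqd_le le_jd _.
have [_ g1] := proj1 (unipotent_partE _ _) (Gg_ 1%N).
exact: peqd_trans (gE 1%N) g1.
Qed.

(** The components of g are chosen one degree after the other by
[orbit_closed_step]; this is needed as the group elements given for the various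
d need not converge. *)
Lemma orbit_closed A B :
  (forall d, exists2 g, unipotent_part G g &
     eqd d (fmul g.1 A) (fmul B g.2)) ->
  exists2 g, unipotent_part G g & fmul g.1 A = fmul B g.2.
Proof.
move=> approx.
pose P i g := forall d, exists g', [/\ unipotent_part G g', peqd i g' g &
  eqd d (fmul g'.1 A) (fmul B g'.2)].
have /choice [F FP] : forall ig, exists g',
    P ig.1 ig.2 -> peqd ig.1 g' ig.2 /\ P ig.1.+1 g'.
  move=> [i g]; have [Pig|nPig] := pselect (P i g); last by exists g.
  by have [g1 ? ?] := orbit_closed_step Pig; exists g1.
pose g_ := fix g_ k := if k is k'.+1 then F (k, g_ k') else one.
have Pg k : P k.+1 (g_ k).
  elim: k => [|k IHk]; last by case: (FP (k.+1, g_ k) IHk).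
  by move=> d; have [g Gg gAB] := approx d; exists g; split=> //;
     case: (proj1 (unipotent_partE _ _) Gg).
have coh k : peqd k (g_ k) (g_ k.+1).
  by have [coh _] := FP (k.+1, g_ k) (Pg k); apply/peqd_sym/(peqd_le _ coh).
have [|g1 g1E] := @eqd_limit _ _ _ _ (fun k => (g_ k).1).
  by move=> k; case: (coh k).
have [|g2 g2E] := @eqd_limit _ _ _ _ (fun k => (g_ k).2).
  by move=> k; case: (coh k).
have gE d : peqd d (g1, g2) (g_ d) by [].
have gAB d : exists g', [/\ unipotent_part G g', peqd d (g1, g2) g' &
    eqd d (fmul g'.1 A) (fmul B g'.2)].
  have [g' [Gg' g'E ?]] := Pg d d; exists g'; split=> //.
  exact: peqd_trans (gE d) (peqd_sym (peqd_le (leqnSn d) g'E)).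
have [g' g'P] := choice gAB.
exists (g1, g2).
  by apply: (@unipotent_limit g') => d; case: (g'P d).
apply: eqdP => d /=; have [_ [/= g1' g2'] g'AB] := g'P d.
apply: eqd_trans (eqd_trans g'AB _); first exact: eqd_fmul.
by apply: eqd_fmul => //; apply: eqd_sym.
Qed.

End Orbits.

(** * Existence and uniqueness of the normal form *)

Section Main.
Variables (R : realType) (K : fieldType) (iota : {rmorphism K -> R[i]}).
Variable cj : K -> K.
Hypothesis cjE : forall a : K, iota (cj a) = conjc (iota a).
Variables (m n p : nat) (G : set (fpair K m n p)).
Hypotheses (lieG : formal_lie_group G) (homG : homogeneous_Lie G).
Implicit Types (g h la : fpair K m n p) (A B C : fmx K p m n).

Lemma normal_at_eqd j B C :
  eqd j.+1 B C -> normal_at cj G j B -> normal_at cj G j C.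
Proof.
move=> BC normB la Gla brC; have la0 := Lie_no_const Gla.
have br := eqd_le (leqnSn _) (eqd_bracketr la0 BC).
rewrite -(fform_eqd cj BC br); apply: normB => //.
exact: eqd_trans (eqd_le (leqnSn _) br) brC.
Qed.

(** If C = g B g^-1 agrees with B below degree d, then g B - B g and C - B have
the same part of degree d, and it is tangent to the orbit. *)
Lemma orbit_tangent d la B C : Lie G la ->
  fmul (pair_exp la).1 B = fmul C (pair_exp la).2 ->
  eqd d B C \/ eqd d (bracket la B) 0 ->
  [/\ eqd d B C, eqd d (bracket la B) 0 & eqd d.+1 (C - B) (bracket la B)].
Proof.
move=> Gla laBC BC; set g := pair_exp la in laBC *; have la0 :=
  Lie_no_const Gla.
have brE : fmul (C - B) g.2 = bracket g B by rewrite /bracket laBC fmulBl.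
have [h _ gh] := unipotent_inv lieG (Lie_exp Gla).
have g2_one : eqd 1 (g.2 - fone) 0 by apply/eqd_sub0; case: (pair_exp_one la).
have CB0 : eqd d (C - B) 0.
  case: BC => [/eqd_sym|] BC; first exact/eqd_sub0.
  have : eqd d (bracket g B) 0 by apply/bracket_exp_eq0.
  rewrite -brE -[X in eqd _ _ X](f0mul m g.2) =>
    /eqd_fmul/(_ (@eqd_refl _ _ _ _ d h.2)).
  by rewrite -!fmulA; case: gh => _ [-> _]; rewrite !fmul1.
have CBg : eqd d.+1 (C - B) (bracket g B).
  rewrite -brE; apply/eqd_sym/eqd_sub0.
  rewrite -[X in _ - X]fmul1 -fmulBr -addn1; exact: eqd_fmul_gr.
have brg0 : eqd d (bracket g B) 0.
  exact: eqd_trans (eqd_sym (eqd_le (leqnSn d) CBg)) CB0.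
have brla0 : eqd d (bracket la B) 0 by apply/bracket_exp_eq0.
split=> //; first exact/eqd_sym/eqd_sub0.
exact: eqd_trans CBg (eqd_bracket_exp la0 brla0).
Qed.

(** By induction B and C agree below degree d; then C - B is in degree d a
tangent vector as in the definition of normality, to which both B and C, hence
C - B itself, are orthogonal. *)
Lemma normal_unique d g B C : unipotent_part G g -> fmul g.1 B = fmul C g.2 ->
  (forall j, (j < d)%N -> normal_at cj G j B /\ normal_at cj G j C) ->
    eqd d B C.
Proof.
move=> Gg gBC; elim: d => [|d IHd] normBC; first exact: eqd0.
have BC : eqd d B C by apply: IHd => j lt_jd; apply/normBC/ltnW.
have [la Gla laE] := unipotent_log lieG Gg; have la0 := Lie_no_const Gla.
rewrite -laE in gBC; have [_ br0 CBbr] := orbit_tangent Gla gBC (or_introl BC).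
have [normB normC] := normBC d (ltnSn d).
have brBC := eqd_bracketr la0 BC.
have CB : fform cj d.+1 C (bracket la B) = 0.
  rewrite (fform_eqd cj (@eqd_refl _ _ _ _ _ C) brBC); apply: normC => //.
  exact: eqd_trans (eqd_sym (eqd_le (leqnSn d) brBC)) br0.
have : fform cj d.+1 (C - B) (bracket la B) = 0.
  by rewrite fformBl CB normB // subrr.
rewrite (fform_eqd cj CBbr (@eqd_refl _ _ _ _ _ _)) => /(vform_def cjE) tr0.
have /ftrunc_eqd br0' : ftrunc d.+1 (bracket la B) = ftrunc d.+1 0.
  by rewrite tr0 ftrunc0.
by apply/eqd_sym/eqd_sub0; apply: eqd_trans CBbr br0'.
Qed.

(** A is moved by exp la, where -(bracket la A) is in degree d the orthogonal
projection of A on the space of tangent vectors without lower part; to first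
order, exp la subtracts this projection from A. *)
Lemma normal_step d A : exists g B, [/\ unipotent_part G g,
  fmul g.1 A = fmul B g.2, eqd d A B & normal_at cj G d B].
Proof.
pose S v := exists la, [/\ Lie G la, eqd d (bracket la A) 0 &
  v = ftrunc d.+1 (bracket la A)].
have [||U US] := @vspace_of_linear _ (tspace K p d.+1 m n) S.
- by exists 0; split; rewrite ?bracket0l ?ftrunc0 //; apply: Lie0.
- move=> a _ _ [la [Gla bla ->]] [mu [Gmu bmu ->]]; exists (a *: la + mu);
  split.
  + by apply: LieD => //; apply: LieZ.
  + rewrite bracketDl bracketZl -(addr0 0); apply: eqdD => //.
    by rewrite -(scaler0 _ a); apply: eqdZ.
  + by rewrite bracketDl bracketZl ftrunc_lin.
have [_ /US [la' [Gla' br' ->]] orth] := vform_projection cjE U (ftrunc d.+1 A).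
pose la := - la'; have Gla : Lie G la by rewrite /la -scaleN1r; apply: LieZ.
have brE : bracket la A = - bracket la' A by rewrite /la -scaleN1r bracketZl
  scaleN1r.
have br0 : eqd d (bracket la A) 0 by rewrite brE -oppr0; apply: eqdN.
have Gg := Lie_exp Gla; have [h Gh gh] := unipotent_inv lieG Gg.
pose g := pair_exp la; pose B := fmul (fmul g.1 A) h.2.
have gAB : fmul g.1 A = fmul B g.2.
  by rewrite /B -fmulA; case: gh => _ [_ ->]; rewrite fmul1.
have [AB _ BAbr] := orbit_tangent Gla gAB (or_intror br0).
have BE : eqd d.+1 B (A - bracket la' A).
  by rewrite -brE -[B](subrK A) [A + _]addrC; apply: eqdD.
exists g, B; split=> // mu Gmu br_mu; have mu0 := Lie_no_const Gmu.
have br_muAB := eqd_bracketr mu0 AB.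
rewrite (fform_eqd cj BE (eqd_sym br_muAB)) /fform ftruncB; apply: orth.
apply/US; exists mu; split=> //.
exact: eqd_trans (eqd_le (leqnSn d) br_muAB) br_mu.
Qed.

Lemma normal_approx A d : exists B, (exists2 g, unipotent_part G g &
  fmul g.1 A = fmul B g.2) /\ forall j, (j < d)%N -> normal_at cj G j B.
Proof.
elim: d => [|d [B [[g Gg gAB] normB]]].
  exists A; split=> //; exists (pair_one K m n p); first exact: unipotent_one.
  by rewrite f1mul fmul1.
have [h [C [Gh hBC BC normC]]] := normal_step d B; exists C; split.
  exists (pair_mul h g); first exact: unipotent_mul.
  by rewrite /= -fmulA gAB !fmulA hBC.
move=> j; rewrite ltnS leq_eqVlt => /orP [/eqP->//|lt_jd].
by apply: normal_at_eqd (normB j lt_jd); apply: eqd_le BC.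
Qed.

Lemma intertwine_divide g h A B C : unipotent_part G g ->
  unipotent_part G h -> fmul g.1 A = fmul B g.2 -> fmul h.1 A = fmul C h.2 ->
  exists2 k, unipotent_part G k & fmul k.1 B = fmul C k.2.
Proof.
move=> Gg Gh gAB hAC; have [g' Gg' gg'] := unipotent_inv lieG Gg.
exists (pair_mul h g'); first exact: unipotent_mul.
have g'BA : fmul g'.1 B = fmul A g'.2.
  by apply: eqdP => d; apply: eqd_intertwine_inv gg' _; rewrite gAB.
by rewrite /= -fmulA g'BA !fmulA hAC.
Qed.

(** Normal forms modulo degree d are unique modulo degree d, hence they
converge, although the group elements that lead to them need not; the limit
stays in the orbit because orbits are closed. *)
Lemma normal_exists A : exists B, (exists2 g, unipotent_part G g &
  fmul g.1 A = fmul B g.2) /\ forall j, normal_at cj G j B.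
Proof.
have [B_ B_P] := choice (normal_approx A).
have [|B BE] := @eqd_limit _ _ _ _ B_.
  move=> d; have [[g Gg gB] normB] := B_P d; have [[h Gh hC] normC] := B_P d.+1.
  have [k Gk kBC] := intertwine_divide Gg Gh gB hC.
  apply: normal_unique Gk kBC _ => j lt_jd.
  by split; [apply: normB | apply/normC/ltnW].
exists B; split=> [|j]; last first.
  have [_ normB] := B_P j.+1.
  by apply: (@normal_at_eqd j (B_ j.+1)); [apply/eqd_sym | apply: normB].
apply: orbit_closed => // d; have [[g Gg gB] _] := B_P d; exists g => //.
by rewrite gB; apply: eqd_fmul => //; apply/eqd_sym.
Qed.

End Main.

(* K is a subfield of the complex numbers (through iota) stable under complex
   conjugation, cj being the restriction of the conjugation to K. *)
Theorem theorem5p4 (R : realType) (K : fieldType)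
  (iota : {rmorphism K -> R[i]}) (cj : K -> K)
  (cjE : forall a : K, iota (cj a) = conjc (iota a))
  (m n p : nat) (m_gt0 : (0 < m)%N) (n_gt0 : (0 < n)%N) (p_gt0 : (0 < p)%N)
  (G : set (fpair K m n p))
  (lieG : formal_lie_group G) (homG : homogeneous_Lie G)
  (A : fmx K p m n) :
  exists! B : fmx K p m n,
    unipotent_equiv G A B /\
    exists f : nat -> fmx K p m n, forall j : nat,
      delta cj G (Dop cj B (phomog j B)) =
      delta cj G (Dop cj B (ptrunc j (f j))).
Proof.
have [B [[g Gg gAB] normB]] := normal_exists cjE lieG homG A.
exists B; split=> [|C [/(unipotent_equivP lieG) [h Gh hAC] [f fP]]].
  split; first by apply/(unipotent_equivP lieG); exists g.
  have [f fP] := choice (fun j => proj2 (normal_atP cjE lieG homG j B) (normB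
    j)).
  by exists f.
have [k Gk kBC] := intertwine_divide lieG Gg Gh gAB hAC.
apply: eqdP => d; apply: (normal_unique cjE lieG Gk kBC) => j _.
by split=> //; apply/(normal_atP cjE lieG homG); exists (f j).
Qed.
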